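(* Let $d\in\mathbb N$, let $A$ be a real $d\times d$ diagonalizable matrix with positive eigenvalues, whose distinct eigenvalues are $0<\lambda_1<\lambda_2<\dots<\lambda_{d_*}$. Let $F:\mathbb R^d\to\mathbb R^d$ be locally Lipschitz with $F(0)=0$, and assume there exist $N_*\in\mathbb N$, strictly increasing numbers $\beta_1,\dots,\beta_{N_*}\in(1,\infty)$, functions $F_k\in\mathcal H_{\beta_k}(\mathbb R^d)\cap C^\infty(\mathbb R^d\setminus\{0\})$ for $1\le k\le N_*$, and a number $\bar\varepsilon>0$ such that $$\Big|F(x)-\sum_{k=1}^{N_*}F_k(x)\Big|=\mathcal O(|x|^{\beta_{N_*}+\bar\varepsilon})\quad\text{as }x\to0.$$ Let $y\in C^1([0,\infty),\mathbb R^d)$ be a solution of $y'+Ay=F(y)$ for $t>0$, with $y(0)\ne0$ and $\lim_{t\to\infty}y(t)=0$. Then there exist an eigenvalue $\lambda_*=\lambda_{n_0}$ of $A$ and a corresponding eigenvector $\xi_*$ with $|y(t)-e^{-\lambda_*t}\xi_*|=\mathcal O(e^{-(\lambda_*+\delta_0)t})$ for some $\delta_0>0$, and, with $\alpha_r$, $\tilde\mu_n$, $\mu_n$, $\mathcal F_{r,m}$ and $\bar N$ defined from $\lambda_*,\xi_*,(\beta_k),(F_k),\bar\varepsilon$ as in the context, there exist $\mathbb R^d$-valued polynomials $q_n(t)$, $1\le n\le\bar N$, and a number $\delta>0$ such that $$\Big|y(t)-\sum_{n=1}^{\bar N}q_n(t)e^{-\mu_nt}\Big|=\mathcal O(e^{-(\mu_{\bar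 N}+\delta)t}),$$ where each $q_n$, $1\le n\le\bar N$, satisfies $$q_n'+(A-\mu_nI_d)q_n=\sum_{r=1}^{N_*}\ \sum_{\substack{m\ge0,\ k_1,\dots,k_m\ge2,\\ \sum_{j=1}^m\tilde\mu_{k_j}+\alpha_r\lambda_*=\tilde\mu_n}}\mathcal F_{r,m}(q_{k_1},q_{k_2},\dots,q_{k_m})\quad\text{in }\mathbb R.$$
   Context: $|\cdot|$ is the Euclidean norm; $\mathbb Z_+=\{0,1,2,\dots\}$; $I_d$ is the identity matrix. For $t$-dependent functions, $f(t)=\mathcal O(h(t))$ means $|f(t)|\le Ch(t)$ for all sufficiently large $t$, for some $C>0$; ''$f(x)=\mathcal O(h(x))$ as $x\to0$'' means there are $r,C>0$ with $|f(x)|\le Ch(x)$ for all $|x|<r$. $\mathcal H_\beta(\mathbb R^d)$ is the set of functions $G:\mathbb R^d\to\mathbb R^d$ with $G(tx)=t^\beta G(x)$ for all $x\in\mathbb R^d$, $t>0$. ''$G\in C^\infty(U)$'' means that the restriction of $G$ to the open set $U$ is infinitely differentiable. Put $\alpha_k=\beta_k-1>0$ and $$\tilde S=\Big\{\sum_{k=n_0}^{d_*}m_k(\lambda_k-\lambda_* )+\sum_{j=1}^{N_*}z_j\alpha_j\lambda_*:\ m_k,z_j\in\mathbb Z_+\Big\}.$$ Arrange the countably infinite set $\tilde S\subset[0,\infty)$ as a strictly increasing sequence $(\tilde\mu_n)_{n=1}^\infty$ (so $\tilde\mu_1=0$), set $\mu_n=\tilde\mu_n+\lambda_*$, and define $$\bar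 N=\max\{N\in\mathbb N:\ \lambda_*(\beta_{N_*}+\bar\varepsilon)>\mu_N\}.$$ For $m\ge0$, $\mathcal F_{r,m}=\frac1{m!}D^mF_r(\xi_* )$, where $D^mF_r(\xi_* )$ is the $m$-th order derivative of $F_r$ at $\xi_*$, an $m$-linear map $(\mathbb R^d)^m\to\mathbb R^d$ for $m\ge1$, and $\mathcal F_{r,0}=F_r(\xi_* )$. The inner sum runs over all $m$ and ordered tuples $(k_1,\dots,k_m)$ satisfying the constraint (a finite sum); for $m=0$ there are no indices $k_j$, the constraint reads $\alpha_r\lambda_*=\tilde\mu_n$, and the term is $F_r(\xi_* )$. An empty sum is zero. *)

(* Defs.v *)
From HB Require Import structures.
From mathcomp Require Import all_boot all_order all_algebra.
From mathcomp Require Import all_classical all_reals all_analysis.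
Import Order.TTheory GRing.Theory Num.Theory numFieldNormedType.Exports.

Set Implicit Arguments.
Unset Strict Implicit.
Unset Printing Implicit Defensive.

Local Open Scope classical_set_scope.
Local Open Scope ring_scope.

(* The library norm on 'cV[R]_d is the maximum norm; the library topology and
   differentiability used below are the same for the Euclidean norm. *)
Definition enorm (R : realType) (d : nat) (x : 'cV[R]_d) : R :=
  Num.sqrt (\sum_(i < d) x i 0 ^+ 2).

(* The Landau notation of the library does not apply to the filter of
   neighbourhoods of +oo in R, hence this common definition for x -> 0 and
   t -> +oo. *)
Definition bigO_at (R : realType) (T : Type) (E : set_system T) (f h : T -> R) :
    Prop :=
  exists C : R, 0 < C /\ \forall x \near E, `|f x| <= C * h x.

Definition locally_lipschitz (R : realType) (d : nat)
    (G : 'cV[R]_d -> 'cV[R]_d) : Prop :=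
  forall x : 'cV[R]_d, exists L : R, \forall u \near x & v \near x,
    enorm (G u - G v) <= L * enorm (u - v).

Definition homogeneous (R : realType) (d : nat) (beta : R)
    (G : 'cV[R]_d -> 'cV[R]_d) : Prop :=
  forall (x : 'cV[R]_d) (t : R), 0 < t -> G (t *: x) = t `^ beta *: G x.

(* mderive G [:: v_1; ...; v_m] x is D^m G(x)(v_1, ..., v_m): the derivative in
   the direction v_1 of z |-> D^(m-1) G(z)(v_2, ..., v_m), taken at x. *)
Fixpoint mderive (R : realType) (d : nat) (G : 'cV[R]_d -> 'cV[R]_d)
    (vs : seq 'cV[R]_d) : 'cV[R]_d -> 'cV[R]_d :=
  if vs is v :: vs' then fun x => 'd (mderive G vs') x v else G.

(* D^m G is differentiable on U iff all its evaluations
   z |-> D^m G(z)(v_1, ..., v_m) are. *)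
Definition smooth_on (R : realType) (d : nat) (U : set 'cV[R]_d)
    (G : 'cV[R]_d -> 'cV[R]_d) : Prop :=
  forall (vs : seq 'cV[R]_d) (x : 'cV[R]_d),
    U x -> differentiable (mderive G vs) x.

(* C^1([0, oo), R^d); at 0 the difference quotient is one-sided.  Values of y
   at negative times are irrelevant. *)
Definition C1_halfline (R : realType) (d : nat) (y : R -> 'cV[R]_d) : Prop :=
  exists dy : R -> 'cV[R]_d,
    {within `[0, +oo[%classic, continuous dy} /\
    forall t, 0 <= t ->
      (s - t)^-1 *: (y s - y t) @[s --> within [set s | 0 <= s] (t^')]
        --> dy t.

(* The distinguished eigenvalue is lam n0, and alpha_j = beta j - 1. *)
Definition Stilde (R : realType) (dstar Nstar n0 : nat) (lam beta : nat -> R) :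
    set R :=
  [set s | exists m z : nat -> nat,
     s = \sum_(n0 <= k < dstar.+1) (m k)%:R * (lam k - lam n0)
         + \sum_(1 <= j < Nstar.+1) (z j)%:R * ((beta j - 1) * lam n0)].

(* Sequences are indexed from 1; mut 0 is unconstrained. *)
Definition increasing_enumeration (R : realType) (mut : nat -> R) (S : set R) :
    Prop :=
  (forall j k : nat, (1 <= j)%N -> (j < k)%N -> mut j < mut k) /\
  mut @` [set n | (1 <= n)%N] = S.

Definition is_max_index (P : nat -> Prop) (N : nat) : Prop :=
  [/\ (1 <= N)%N, P N & forall n : nat, (1 <= n)%N -> P n -> (n <= N)%N].

Definition Fcal (R : realType) (d : nat) (G : 'cV[R]_d -> 'cV[R]_d)
    (xi : 'cV[R]_d) (vs : seq 'cV[R]_d) : 'cV[R]_d :=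
  ((size vs)`!)%:R^-1 *: mderive G vs xi.

(* R^d-valued polynomials are columns of polynomials. *)
Definition peval (R : realType) (d : nat) (q : 'cV[{poly R}]_d) (t : R) :
    'cV[R]_d :=
  map_mx (fun p : {poly R} => p.[t]) q.

(* The tuples (k_1, ..., k_m), for all m >= 0, with k_j >= 2 and
   mut k_1 + ... + mut k_m + a = mut n. *)
Definition index_tuples (R : realType) (mut : nat -> R) (a : R) (n : nat) :
    set (seq nat) :=
  [set ks | all (leq 2) ks /\ \sum_(k <- ks) mut k + a = mut n].

(* Main.v *)
Require Import Defs.
From HB Require Import structures.
From mathcomp Require Import all_boot all_order all_algebra.
From mathcomp Require Import all_classical all_reals all_analysis.
From mathcomp Require Import ring lra zify.
Import Order.TTheory GRing.Theory Num.Theory numFieldNormedType.Exports.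

Set Implicit Arguments.
Unset Strict Implicit.
Unset Printing Implicit Defensive.

Local Open Scope classical_set_scope.
Local Open Scope ring_scope.

(** Diagonalize [A].  In the coordinates [z = P *m y] the equation is a
    diagonal system [z_i' + a_i z_i = f_i], and [|f| <= C |z| ^ b] near the
    origin for some [b > 1], because a homogeneous map that is continuous off
    the origin is bounded by a multiple of [|x| ^ beta]
    ([homogeneous_bound], by compactness of the unit sphere).

    The leading term.  The energy [sum_i z_i ^ 2] satisfies
    [- K energy <= energy' <= - m energy] once [z] is small.  Hence [z] decays
    exponentially, never vanishes, and cannot decay faster than every
    exponential.  If [z = O(exp (- s t))] then [f = O(exp (- b s t))], and the
    scalar equations give [z_i = c_i exp (- a_i t) + O(exp (- k s t))] with
    [k = (1 + b) / 2 > 1] ([scalar_asymptotics]).  Either all the exponentials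
    that matter have a zero coefficient, and the decay rate of [z] has been
    multiplied by [k], or the slowest one with a nonzero coefficient is the
    leading term.  The first case cannot occur forever
    ([leading_exponential]).

    The expansion.  It is built one exponent at a time.  Write [L] for the
    leading eigenvalue, [y = exp (- L t) (xi + u)], and let [U] be the part of
    [u] described by the first [N] terms.  By homogeneity
    [F_r y = exp (- beta_r L t) F_r (xi + u)]; replacing [u] by [U] costs a
    Lipschitz estimate, and the Taylor formula at [xi], where [F_r] is smooth,
    followed by multilinearity of the derivatives, turns [F_r (xi + U)] into a
    sum of polynomials times exponentials.  Their exponents are sums
    [alpha_r L + mut k_1 + ... + mut k_m], which belong to the semigroup of
    exponents.  Those not exceeding [mut N.+1] are the terms on the right-hand
    sides for [n <= N.+1], and all the others are negligible
    ([homogeneous_expansion]).  The remainder of [y] after [N] terms therefore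
    solves, coordinate by coordinate, a linear equation forced by a polynomial
    times [exp (- mu_N.+1 t)] up to a faster term.  A polynomial particular
    solution yields the next coefficient; the homogeneous part
    [c exp (- a_i t)] is absorbed by it when [a_i = mu_N.+1], is negligible
    when [a_i] is larger, and is excluded by the known decay of the remainder
    when [a_i] is smaller, since then [a_i <= mu_N]
    ([coordinate_coefficient], [next_coefficient]). *)

(** * Exponential decay rates *)

Section DecayRates.
Context {R : realType}.
Implicit Types (rho a : R).

(** The rate may be negative, so that a polynomial decays at every negative
    rate. *)
Definition decays {V : normedModType R} rho (f : R -> V) : Prop :=
  exists C, \forall t \near +oo, `|f t| <= C * expR (- rho * t).

Lemma decays_pos {V : normedModType R} rho (f : R -> V) : decays rho f ->
  exists2 C, 0 < C & \forall t \near +oo, `|f t| <= C * expR (- rho * t).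
Proof.
move=> [C fC]; exists (`|C| + 1); first by rewrite ltr_wpDl.
near=> t; apply: (@le_trans _ _ (C * expR (- rho * t))); first by near: t.
by rewrite ler_wpM2r ?expR_ge0// ler_wpDr// ler_norm.
Unshelve. all: by end_near. Qed.

Lemma decays_dominated {V W : normedModType R} rho (K : R) (f : R -> V)
    (g : R -> W) : decays rho f ->
  (\forall t \near +oo, `|g t| <= K * `|f t|) -> decays rho g.
Proof.
move=> /decays_pos[C C0 fC] gf; exists (`|K| * C); near=> t.
apply: (@le_trans _ _ (K * `|f t|)); first by near: t.
apply: (@le_trans _ _ (`|K| * `|f t|)).
  by rewrite ler_wpM2r// ler_norm.
by rewrite -mulrA ler_wpM2l//; near: t.
Unshelve. all: by end_near. Qed.

Lemma decays_eq {V : normedModType R} rho (f g : R -> V) :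
  (\forall t \near +oo, f t = g t) -> decays rho f -> decays rho g.
Proof.
move=> fg df; apply: (decays_dominated (K := 1) df).
by apply: filterS fg => t ->; rewrite mul1r.
Qed.

Lemma decays_weaken {V : normedModType R} rho rho' (f : R -> V) :
  rho' <= rho -> decays rho f -> decays rho' f.
Proof.
move=> rr /decays_pos[C C0 fC]; exists C; near=> t.
apply: (@le_trans _ _ (C * expR (- rho * t))); first by near: t.
by rewrite ler_wpM2l ?(ltW C0)// ler_expR !mulNr lerN2 ler_wpM2r.
Unshelve. all: by end_near. Qed.

Lemma decays0 {V : normedModType R} rho : decays rho (fun=> 0 : V).
Proof. by exists 0; near=> t; rewrite normr0 mul0r. Unshelve. all: by end_near. Qed.

Lemma decays_cst {V : normedModType R} (v : V) : decays 0 (fun=> v).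
Proof.
by exists `|v|; near=> t; rewrite oppr0 mul0r expR0 mulr1.
Unshelve. all: by end_near. Qed.

Lemma decays_expR a : decays a (fun t => expR (- a * t)).
Proof.
by exists 1; near=> t; rewrite mul1r ger0_norm ?expR_ge0.
Unshelve. all: by end_near. Qed.

Lemma decaysD {V : normedModType R} rho (f g : R -> V) :
  decays rho f -> decays rho g -> decays rho (fun t => f t + g t).
Proof.
move=> [C fC] [D gD]; exists (C + D); near=> t.
rewrite (le_trans (ler_normD _ _))// mulrDl lerD//; near: t => //.
Unshelve. all: by end_near. Qed.

Lemma decaysN {V : normedModType R} rho (f : R -> V) :
  decays rho f -> decays rho (fun t => - f t).
Proof. by move=> [C fC]; exists C; apply: filterS fC => t; rewrite normrN. Qed.

Lemma decaysB {V : normedModType R} rho (f g : R -> V) :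
  decays rho f -> decays rho g -> decays rho (fun t => f t - g t).
Proof. by move=> df dg; apply: decaysD => //; exact: decaysN. Qed.

Lemma decays_sum {V : normedModType R} (I : eqType) (r : seq I) (P : pred I) rho
    (f : I -> R -> V) :
  (forall i, i \in r -> P i -> decays rho (f i)) ->
  decays rho (fun t => \sum_(i <- r | P i) f i t).
Proof.
elim: r => [_|i r ih df].
  by apply: decays_eq (decays0 rho); near=> t; rewrite big_nil.
have {}ih : decays rho (fun t => \sum_(i <- r | P i) f i t).
  by apply: ih => j jr; apply: df; rewrite in_cons jr orbT.
have [Pi|Pi] := boolP (P i); last first.
  by apply: decays_eq ih; near=> t; rewrite big_cons (negbTE Pi).
apply: decays_eq (decaysD (df i (mem_head _ _) Pi) ih).
by near=> t; rewrite big_cons Pi.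
Unshelve. all: by end_near. Qed.

Lemma decaysZ {V : normedModType R} rho rho' (g : R -> R) (f : R -> V) :
  decays rho g -> decays rho' f -> decays (rho + rho') (fun t => g t *: f t).
Proof.
move=> /decays_pos[C C0 gC] /decays_pos[D D0 fD]; exists (C * D); near=> t.
rewrite normrZ opprD mulrDl expRD mulrACA ler_pM//; near: t => //.
Unshelve. all: by end_near. Qed.

Lemma decaysM rho rho' (f g : R -> R) :
  decays rho f -> decays rho' g -> decays (rho + rho') (fun t => f t * g t).
Proof. exact: decaysZ. Qed.

(** From [1 + x <= exp x] at [x = e t]. *)
Lemma decays_id (e : R) : 0 < e -> decays (- e) (id : R -> R).
Proof.
move=> e0; exists e^-1; near=> t.
rewrite opprK ger0_norm; last by near: t; exact: nbhs_pinfty_ge.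
rewrite mulrC ler_pdivlMr// mulrC.
by apply: le_trans (expR_ge1Dx _); rewrite ler_wpDl.
Unshelve. all: by end_near. Qed.

Lemma decays_horner (e : R) (p : {poly R}) :
  0 < e -> decays (- e) (fun t => p.[t]).
Proof.
elim/poly_ind: p e => [|p c ih] e e0.
  by apply: decays_eq (decays0 _); near=> t; rewrite horner0.
(* Half of the loss [e] pays for the factor [t], the other half for the
   polynomial of smaller degree. *)
have e2 : 0 < e / 2 by rewrite divr_gt0.
have dX := decaysM (ih _ e2) (decays_id e2).
rewrite -opprD -splitr in dX.
have dc : decays (- e) (fun=> c).
  by apply: decays_weaken (decays_cst c); rewrite oppr_le0 ltW.
by apply: decays_eq (decaysD dX dc); near=> t; rewrite hornerMXaddC.
Unshelve. all: by end_near. Qed.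

Lemma decays_cvg0 {V : normedModType R} rho (f : R -> V) :
  0 < rho -> decays rho f -> f t @[t --> +oo] --> (0 : V).
Proof.
move=> r0 /decays_pos[C C0 fC]; apply/norm_cvg0P.
have h : C * expR (- (rho * t)) @[t --> +oo] --> C * 0.
  apply: cvgMl_tmp; apply: (@cvg_comp _ _ _ (fun t => rho * t) (fun x => expR (- x))
    _ +oo%R); last exact: cvgr_expR.
  exact: gt0_cvgMry.
rewrite mulr0 in h.
apply: (squeeze_cvgr _ (cvg_cst 0) h).
by near=> t; rewrite normr_ge0 /= -mulNr; near: t.
Unshelve. all: by end_near. Qed.

(** Multiplication by [exp (a t)] leaves a constant that tends to zero. *)
Lemma decays_exp_coef0 a rho (c : R) :
  a < rho -> decays rho (fun t => c * expR (- a * t)) -> c = 0.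
Proof.
move=> ar dc.
have dc' : decays (rho - a) (fun=> c).
  have dE : decays (- a) (fun t => expR (a * t)).
    by apply: decays_eq (decays_expR (- a)); near=> t; rewrite opprK.
  apply: decays_eq (decaysM dc dE); near=> t.
  by rewrite -mulrA -expRD -mulrDl addNr mul0r expR0 mulr1.
have c0 := decays_cvg0 (_ : 0 < rho - a) dc'.
rewrite subr_gt0 in c0.
have {}c0 := c0 ar.
exact: (@cvg_unique _ (@norm_hausdorff _ _) _ _ _ _ (cvg_cst c) c0).
Unshelve. all: by end_near. Qed.

Lemma decays_powR {V W : normedModType R} (s p C : R) (f : R -> V) (g : R -> W) :
  0 <= p -> decays s f -> (\forall t \near +oo, `|g t| <= C * `|f t| `^ p) ->
  decays (p * s) g.
Proof.
move=> p0 /decays_pos[D D0 fD] gf; exists (`|C| * D `^ p); near=> t.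
rewrite (@le_trans _ _ (`|C| * `|f t| `^ p))//.
  rewrite (@le_trans _ _ (C * `|f t| `^ p))//; first by near: t.
  by rewrite ler_wpM2r ?powR_ge0// ler_norm.
rewrite -mulrA ler_wpM2l//.
have -> : - (p * s) * t = (- s * t) * p by ring.
rewrite expRM -powRM ?(ltW D0) ?expR_ge0//.
apply: ge0_ler_powR; rewrite ?nnegrE ?mulr_ge0 ?expR_ge0 ?(ltW D0)//.
by near: t.
Unshelve. all: by end_near. Qed.

End DecayRates.

(** * Scalar linear equations with a decaying forcing term *)

Section ScalarEquations.
Context {R : realType}.
Implicit Types (f df w h z g : R -> R) (a k rho s t T : R).

Lemma nincr_of_derive_le0 T f df :
  (forall t, T < t -> is_derive t (1 : R) f (df t)) -> (forall t, T < t -> df t <= 0) ->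
  forall s t, T < s -> s <= t -> f t <= f s.
Proof.
move=> fdf df0 s t Ts st.
have der x : s <= x -> derivable f x 1.
  by move=> sx; have [] := fdf x (lt_le_trans Ts sx).
apply: (@ler0_derive1_nincry _ f s) => //.
- by move=> x; rewrite in_itv/= andbT => /ltW/der.
- move=> x; rewrite in_itv/= andbT => sx; rewrite derive1E.
  have Tx := lt_trans Ts sx.
  by have -> := @derive_val _ _ _ _ _ _ _ (fdf _ Tx); exact: df0.
- apply: derivable_within_continuous => x.
  by rewrite in_itv/= andbT; exact: der.
Qed.

Lemma ndecr_of_derive_ge0 T f df :
  (forall t, T < t -> is_derive t (1 : R) f (df t)) -> (forall t, T < t -> 0 <= df t) ->
  forall s t, T < s -> s <= t -> f s <= f t.
Proof.
move=> fdf df0 s t Ts st; rewrite -lerN2.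
apply: (@nincr_of_derive_le0 T (fun x => - f x) (fun x => - df x)) => // x Tx.
  by have ? := fdf _ Tx; exact: is_deriveN.
by rewrite oppr_le0 df0.
Qed.

Lemma is_derive_expRM a t :
  is_derive t (1 : R) (fun t => expR (a * t)) (a * expR (a * t)).
Proof.
have d1 : is_derive t (1 : R) (fun t => a * t) a.
  by apply: is_derive_eq; rewrite -[LHS]/(a * 1) mulr1.
by rewrite mulrC; exact: (is_derive1_comp (is_derive_expR _) d1).
Qed.

(** The two functions [w +- (C / k) exp (- k t)] are monotone as soon as
    [|w'| <= C exp (- k t)]; this replaces integration from [t] to infinity
    when [k > 0], and from a fixed time to [t] when [k < 0]. *)
Lemma barrier_monotone k w h : k != 0 ->
  (\forall t \near +oo, is_derive t (1 : R) w (h t)) -> decays k h ->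
  exists T C, [/\ 0 < C,
    forall s t, T < s -> s <= t ->
      w t + C / k * expR (- k * t) <= w s + C / k * expR (- k * s) &
    forall s t, T < s -> s <= t ->
      w s - C / k * expR (- k * s) <= w t - C / k * expR (- k * t)].
Proof.
move=> k0 dw /decays_pos[C C0 hC].
have [T [_ TC]] : \forall t \near +oo,
    is_derive t (1 : R) w (h t) /\ `|h t| <= C * expR (- k * t).
  by near=> t; split; near: t.
exists T, C.
have dE t : is_derive t (1 : R) (fun t => C / k * expR (- k * t))
    (- (C * expR (- k * t))).
  have ? := is_derive_expRM (- k) t.
  apply: is_derive_eq; rewrite -[LHS]/(C / k * (- k * expR (- k * t))).
  by field.
split=> //.
- apply: (@nincr_of_derive_le0 T (fun t => w t + C / k * expR (- k * t))
    (fun t => h t - C * expR (- k * t))) => t /TC[dwt hle].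
    by have ? := dE t; exact: is_deriveD.
  by rewrite subr_le0 (le_trans _ hle)// ler_norm.
- apply: (@ndecr_of_derive_ge0 T (fun t => w t - C / k * expR (- k * t))
    (fun t => h t + C * expR (- k * t))) => t /TC[dwt hle].
    have ? := dE t.
    by rewrite -[X in is_derive _ _ _ (_ + X)]opprK; exact: is_deriveB.
  by rewrite -lerBlDr sub0r lerNl (le_trans _ hle)// -normrN ler_norm.
Unshelve. all: by end_near. Qed.

Lemma primitive_converges k w h : 0 < k ->
  (\forall t \near +oo, is_derive t (1 : R) w (h t)) -> decays k h ->
  exists c, decays k (fun t => w t - c).
Proof.
move=> k0 dw dh.
have [T [C [C0 up dn]]] := barrier_monotone (lt0r_neq0 k0) dw dh.
set e := fun t => C / k * expR (- k * t) in up dn.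
have e0 t : 0 <= e t by rewrite mulr_ge0 ?divr_ge0 ?expR_ge0 ?ltW.
(* The limit is squeezed between the increasing function [w - e] and the
   decreasing function [w + e]: it is the supremum of the former. *)
pose S := [set w t - e t | t in [set t | T < t]].
have ubS s : T < s -> ubound S (w s + e s).
  move=> Ts _ [t Tt <-].
  have tm : t <= Num.max s t by rewrite le_max lexx orbT.
  have sm : s <= Num.max s t by rewrite le_max lexx.
  apply: le_trans (dn _ _ Tt tm) _; apply: le_trans (up _ _ Ts sm).
  by rewrite lerD2l (@le_trans _ _ 0) ?oppr_le0//; exact: e0.
have T1 : T < T + 1 by rewrite ltrDl.
have S0 : S !=set0 by exists (w (T + 1) - e (T + 1)); exists (T + 1).
exists (sup S), (C / k); near=> t.
have Tt : T < t by near: t; apply: nbhs_pinfty_gt; exact: num_real.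
have le_sup : w t - e t <= sup S.
  by apply: ub_le_sup; [exists (w t + e t); exact: ubS|exists t].
have sup_le : sup S <= w t + e t by apply: ge_sup => //; exact: ubS.
by rewrite -/(e t) ler_norml; apply/andP; split; lra.
Unshelve. all: by end_near. Qed.

Lemma primitive_grows k w h : k < 0 ->
  (\forall t \near +oo, is_derive t (1 : R) w (h t)) -> decays k h -> decays k w.
Proof.
move=> k0 dw dh.
have [T [C [C0 up dn]]] := barrier_monotone (ltr0_neq0 k0) dw dh.
set e := fun t => C / k * expR (- k * t) in up dn.
have T1 : T < T + 1 by rewrite ltrDl.
pose M := `|w (T + 1)| + `|e (T + 1)|.
exists (M - C / k); near=> t.
have Tt : T + 1 <= t by near: t; apply: nbhs_pinfty_ge; exact: num_real.
have E1 : 1 <= expR (- k * t).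
  by rewrite -expR0 ler_expR mulr_ge0 ?oppr_ge0 ?ltW.
have ME : M <= M * expR (- k * t) by rewrite ler_peMr// addr_ge0.
rewrite mulrBl -/(e t) (le_trans _ (lerD ME (lexx _)))// ler_norml.
have := up _ _ T1 Tt; have := dn _ _ T1 Tt.
rewrite -/(e t) -/(e (T + 1)) /M.
have := ler_norm (w (T + 1)); have := ler_norm (e (T + 1)).
have := ler_norm (- w (T + 1)); have := ler_norm (- e (T + 1)).
rewrite !normrN => ? ? ? ? ? ?; apply/andP; split; lra.
Unshelve. all: by end_near. Qed.

(** A solution of [z' + a z = g] is the homogeneous solution plus a remainder
    that decays almost as fast as [g]; the loss in the rate absorbs the factor
    [t] of the resonance [a = rho]. *)
Lemma scalar_asymptotics a rho rho' z g : rho' < rho ->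
  (\forall t \near +oo, is_derive t (1 : R) z (g t - a * z t)) -> decays rho g ->
  exists c, decays rho' (fun t => z t - c * expR (- a * t)).
Proof.
move=> rr dz dg; pose w t := expR (a * t) * z t.
have dw : \forall t \near +oo, is_derive t (1 : R) w (expR (a * t) * g t).
  near=> t; have ? : is_derive t (1 : R) z (g t - a * z t) by near: t.
  have ? := is_derive_expRM a t.
  apply: is_derive_eq.
  rewrite -[LHS]/(expR (a * t) * (g t - a * z t) + z t * (a * expR (a * t))).
  by ring.
have dE : decays (- a) (fun t => expR (a * t)).
  by apply: decays_eq (decays_expR (- a)); near=> t; rewrite opprK.
have dEN := decays_expR a.
have [arho|arho] := ltP a rho.
  have dh := decaysM dE dg.
  have ra0 : 0 < - a + rho by rewrite addrC subr_gt0.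
  have [c dc] := primitive_converges ra0 dw dh.
  exists c; apply: (decays_weaken (ltW rr)).
  have := decaysM dEN dc; rewrite addrA subrr add0r; apply: decays_eq.
  near=> t; rewrite mulrBr mulrA -expRD -mulrDl addNr mul0r expR0 mul1r.
  by rewrite mulrC.
exists 0.
have dh := decaysM dE (decays_weaken (ltW rr) dg).
have ra0 : - a + rho' < 0 by rewrite addrC subr_lt0 (lt_le_trans rr).
have dc := primitive_grows ra0 dw dh.
have := decaysM dEN dc; rewrite addrA subrr add0r; apply: decays_eq.
near=> t; rewrite mul0r subr0 /w mulrA -expRD -mulrDl addNr mul0r expR0.
by rewrite mul1r.
Unshelve. all: by end_near. Qed.

End ScalarEquations.

(** * Column vectors and the maximum norm *)

Section ColumnNorms.
Context {R : realType} {d : nat}.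
Implicit Types x : 'cV[R]_d.

Lemma coord_le_norm x i : `|x i 0| <= `|x|.
Proof.
by rewrite [leRHS]/Num.norm/= mx_normrE; exact: (le_bigmax _ _ (i, 0)).
Qed.

Lemma norm_le_of_coord x c : 0 <= c -> (forall i, `|x i 0| <= c) -> `|x| <= c.
Proof.
move=> c0 xc; rewrite [leLHS]/Num.norm/= mx_normrE bigmax_le// => -[i j] _.
by rewrite (ord1 j); exact: xc.
Qed.

Lemma norm_le_sum_coord x : `|x| <= \sum_i `|x i 0|.
Proof.
apply: norm_le_of_coord; first exact: sumr_ge0.
by move=> i; rewrite (bigD1 i)//= lerDl sumr_ge0.
Qed.

Lemma enorm_ge0 x : 0 <= enorm x. Proof. exact: sqrtr_ge0. Qed.

Lemma norm_le_enorm x : `|x| <= enorm x.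
Proof.
apply: norm_le_of_coord (enorm_ge0 x) _ => i.
rewrite -sqrtr_sqr ler_sqrt; last by apply: sumr_ge0 => j _; exact: sqr_ge0.
by rewrite (bigD1 i)//= lerDl sumr_ge0// => j _; exact: sqr_ge0.
Qed.

Lemma enorm_le_norm x : enorm x <= Num.sqrt d%:R * `|x|.
Proof.
rewrite -[X in _ * X]normr_id -sqrtr_sqr -sqrtrM ?ler0n// ler_wsqrtr//.
rewrite mulr_natl -[X in _ *+ X]card_ord -sumr_const.
apply: ler_sum => i _; rewrite -[leLHS]ger0_norm ?sqr_ge0// normrX.
by rewrite lerXn2r ?nnegrE// coord_le_norm.
Qed.

Lemma norm_mulmx_le (m : nat) (P : 'M[R]_(m, d)) :
  exists2 K, 0 < K & forall x, `|P *m x| <= K * `|x|.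
Proof.
exists (1 + \sum_i \sum_j `|P i j|).
  by rewrite ltr_pwDl// sumr_ge0// => i _; exact: sumr_ge0.
move=> x; rewrite [leLHS]/Num.norm/= mx_normrE bigmax_le//.
  by rewrite mulr_ge0// addr_ge0// sumr_ge0// => i _; exact: sumr_ge0.
move=> [i j] _ /=; rewrite (ord1 j) mxE (le_trans (ler_norm_sum _ _ _))//.
apply: (@le_trans _ _ (\sum_j `|P i j| * `|x|)).
  by apply: ler_sum => k _; rewrite normrM ler_wpM2l// coord_le_norm.
rewrite -mulr_suml ler_wpM2r// ler_wpDl// [leRHS](bigD1 i)//= lerDl.
by apply: sumr_ge0 => k _; exact: sumr_ge0.
Qed.

Lemma decays_coordP rho (f : R -> 'cV[R]_d) :
  decays rho f <-> forall i, decays rho (fun t => f t i 0).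
Proof.
split=> [df i|df].
  apply: (decays_dominated (K := 1) df); near=> t.
  by rewrite mul1r coord_le_norm.
have dn i : decays rho (fun t => `|f t i 0|).
  by apply: (decays_dominated (K := 1) (df i)); near=> t; rewrite normr_id mul1r.
have := @decays_sum _ _ _ (enum 'I_d) predT _ _ (fun i _ _ => dn i).
move=> /(decays_dominated (K := 1)); apply; near=> t.
rewrite mul1r ger0_norm ?big_enum ?sumr_ge0//; exact: norm_le_sum_coord.
Unshelve. all: by end_near. Qed.

Lemma decays_mulmx (m : nat) (P : 'M[R]_(m, d)) rho (f : R -> 'cV[R]_d) :
  decays rho f -> decays rho (fun t => P *m f t).
Proof.
have [K K0 PK] := norm_mulmx_le P.
by move=> df; apply: (decays_dominated df); near=> t; exact: PK.
Unshelve. all: by end_near. Qed.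

Lemma bigO_enorm_decays rho (f : R -> 'cV[R]_d) : decays rho f ->
  bigO_at (pinfty_nbhs R) (fun t => enorm (f t)) (fun t => expR (- rho * t)).
Proof.
move=> /decays_pos[C C0 fC]; exists ((Num.sqrt d%:R + 1) * C); split.
  by rewrite mulr_gt0// ltr_wpDl ?sqrtr_ge0.
near=> t; rewrite ger0_norm ?enorm_ge0// (le_trans (enorm_le_norm _))//.
rewrite -mulrA ler_pM ?sqrtr_ge0 ?lerDl//; near: t; exact: fC.
Unshelve. all: by end_near. Qed.

End ColumnNorms.

(** * Superlinear perturbations of a diagonal linear system *)

Lemma finite_gap {R : realType} {d : nat} (rho : 'I_d -> R) (l : R) :
  (forall j, l < rho j) -> exists2 e, 0 < e & forall j, l + e <= rho j.
Proof.
move=> lrho; exists (\big[Num.min/1]_j (rho j - l)).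
  by apply: lt_bigmin => // j _; rewrite subr_gt0.
by move=> j; rewrite addrC -lerBrDr; exact: bigmin_le.
Qed.

Lemma powR_superlinear {R : realType} (C b eta : R) : 1 < b -> 0 < eta ->
  exists2 r, 0 < r & forall x, 0 <= x -> x <= r -> C * x `^ b <= eta * x.
Proof.
move=> b1 eta0; pose C' := `|C| + 1; have C'0 : 0 < C' by rewrite ltr_wpDl.
have b0 : 0 < b - 1 by rewrite subr_gt0.
(* The radius at which [C' r ^ (b - 1) = eta]. *)
exists ((eta / C') `^ (b - 1)^-1); first by rewrite powR_gt0// divr_gt0.
move=> x x0 xr; rewrite -(mulr_powRB1 x0); last by rewrite (lt_trans ltr01).
rewrite mulrCA mulrC ler_wpM2r//.
apply: (@le_trans _ _ (C' * x `^ (b - 1))).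
  by rewrite ler_wpM2r ?powR_ge0// ler_wpDr// ler_norm.
rewrite -ler_pdivlMl// mulrC.
have := @ge0_ler_powR _ (b - 1) (ltW b0) _ _ _ _ xr.
rewrite -powRrM mulVf ?lt0r_neq0// powRr1 ?divr_ge0 ?(ltW eta0) ?(ltW C'0)//.
by apply; rewrite nnegrE// powR_ge0.
Qed.

Lemma geometric_exceeds {R : realType} (s k M : R) : 0 < s -> 1 < k ->
  exists n, M <= s * k ^+ n.
Proof.
move=> s0 k1; have lk : 0 < ln k by rewrite ln_gt0.
have [n nM] : exists n : nat, M / s / ln k < n%:R.
  by exists (Num.truncn (`|M / s / ln k|)).+1; rewrite (le_lt_trans (ler_norm _))// truncnS_gt.
exists n; rewrite mulrC -ler_pdivrMr//.
have k0 : 0 < k by rewrite (lt_trans ltr01).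
rewrite -(lnK (_ : k \in Num.pos)) ?posrE// -expRM_natl.
apply: le_trans (expR_ge1Dx _); rewrite ler_wpDl//.
by rewrite -ler_pdivrMr// ltW.
Qed.

Section PerturbedDiagonal.
Context {R : realType} {d : nat}.
Implicit Types (eta s t x : R).
Variables (a : 'I_d -> R) (z f : R -> 'cV[R]_d) (r b C : R).
Hypothesis a_gt0 : forall i, 0 < a i.
Hypothesis dz : forall (t : R) i, 0 < t ->
  is_derive t (1 : R) (fun s => z s i 0) (f t i 0 - a i * z t i 0).
Hypothesis r_gt0 : 0 < r.
Hypothesis b_gt1 : 1 < b.
Hypothesis f_le : forall t, `|z t| <= r -> `|f t| <= C * `|z t| `^ b.
Hypothesis z_cvg0 : z t @[t --> +oo] --> (0 : 'cV[R]_d).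
Hypothesis z_start : \forall t \near (0 : R)^'+, z t <> 0.

Let energy t := \sum_i z t i 0 ^+ 2.
Let denergy t := \sum_i 2 * z t i 0 * (f t i 0 - a i * z t i 0).

Let energy_ge0 t : 0 <= energy t.
Proof. by apply: sumr_ge0 => i _; exact: sqr_ge0. Qed.

Let is_derive_energy t : 0 < t -> is_derive t (1 : R) energy (denergy t).
Proof.
move=> t0.
have -> : energy = \sum_i (fun s => z s i 0 ^+ 2).
  by apply/funext => s; rewrite fct_sumE.
apply: is_derive_sum => i; have := @is_deriveX _ _ (fun s => z s i 0) 2 _ _ _ (dz i t0).
by rewrite expr1.
Qed.

Let sqr_norm_le_energy t : `|z t| ^+ 2 <= energy t.
Proof.
rewrite -[leRHS]sqr_sqrtr// lerXn2r ?nnegrE ?sqrtr_ge0//.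
exact: norm_le_enorm.
Qed.

Let energy_eq0 t : energy t = 0 -> z t = 0.
Proof.
move=> E0; apply/eqP; rewrite -normr_eq0 -sqrf_eq0 eq_le sqr_ge0 andbT -E0.
exact: sqr_norm_le_energy.
Qed.

Let energy_gt0 t : z t <> 0 -> 0 < energy t.
Proof.
by move=> zt; rewrite lt_def energy_ge0 andbT; apply/eqP => /energy_eq0.
Qed.

Let denergy_le eta t : 0 <= eta -> `|f t| <= eta * `|z t| ->
  `|denergy t + \sum_i 2 * a i * z t i 0 ^+ 2| <= 2 * d%:R * eta * energy t.
Proof.
move=> eta0 feta; rewrite -big_split/= (le_trans (ler_norm_sum _ _ _))//.
apply: (@le_trans _ _ (\sum_(i < d) 2 * (eta * `|z t| ^+ 2))).
  apply: ler_sum => i _.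
  have -> : 2 * z t i 0 * (f t i 0 - a i * z t i 0) + 2 * a i * z t i 0 ^+ 2
    = 2 * (z t i 0 * f t i 0) by ring.
  rewrite normrM ger0_norm// ler_wpM2l// normrM expr2 mulrCA ler_pM//.
    exact: coord_le_norm.
  by rewrite (le_trans (coord_le_norm _ _)).
rewrite sumr_const card_ord -[leLHS]mulr_natl mulrCA -!mulrA ler_wpM2l//.
by rewrite !ler_wpM2l.
Qed.

Let forcing_small eta : 0 < eta ->
  exists2 r', 0 < r' & forall t, `|z t| <= r' -> `|f t| <= eta * `|z t|.
Proof.
move=> eta0; have [r' r'0 small] := powR_superlinear C b_gt1 eta0.
exists (Num.min r r'); first by rewrite lt_min r_gt0.
move=> t; rewrite le_min => /andP[zr zr'].
by rewrite (le_trans (f_le zr))// small.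
Qed.

Let near_small r' : 0 < r' ->
  exists2 T, 0 < T & forall t, T < t -> `|z t| <= r'.
Proof.
move=> r'0; have /cvgr0_norm_le/(_ _ r'0)[T [_ zT]] := z_cvg0.
exists (Num.max 1 T); first by rewrite lt_max ltr01.
by move=> t; rewrite gt_max => /andP[_]; exact: zT.
Qed.

(** The energy satisfies [energy' <= - m energy] once the solution is small,
    where [m] is a positive lower bound of the eigenvalues. *)
Let solution_decays : exists2 s, 0 < s & decays s z.
Proof.
have [m m0 am] := finite_gap a_gt0.
pose eta := m / (2 * d%:R + 1).
have D0 : 0 < 2 * d%:R + 1 :> R by rewrite ltr_wpDl// mulr_ge0.
have eta0 : 0 < eta by rewrite divr_gt0.
have etam : 2 * d%:R * eta <= m.
  by rewrite /eta mulrCA ler_piMr ?(ltW m0)// ler_pdivrMr// mul1r lerDl.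
have [r' r'0 fsmall] := forcing_small eta0.
have [T T0 zT] := near_small r'0.
pose V t := expR (m * t) * energy t.
have dV t : T < t ->
    is_derive t (1 : R) V (expR (m * t) * (denergy t + m * energy t)).
  move=> Tt; have ? := is_derive_energy (lt_trans T0 Tt).
  have ? := is_derive_expRM m t.
  apply: is_derive_eq.
  rewrite -[LHS]/(expR (m * t) * denergy t + energy t * (m * expR (m * t))).
  by ring.
have V_le t : T < t -> expR (m * t) * (denergy t + m * energy t) <= 0.
  move=> Tt; rewrite pmulr_rle0 ?expR_gt0//.
  have := denergy_le (ltW eta0) (fsmall _ (zT _ Tt)).
  rewrite ler_norml => /andP[_].
  have : 2 * m * energy t <= \sum_i 2 * a i * z t i 0 ^+ 2.
    rewrite mulr_sumr; apply: ler_sum => i _.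
    by rewrite ler_wpM2r ?sqr_ge0// ler_wpM2l// -[leLHS]add0r.
  have : 2 * d%:R * eta * energy t <= m * energy t by rewrite ler_wpM2r.
  lra.
pose M := V (T + 1).
have T1 : T < T + 1 by rewrite ltrDl.
exists (m / 2); first by rewrite divr_gt0.
exists (Num.sqrt M); near=> t.
have Tt : T + 1 <= t by near: t; apply: nbhs_pinfty_ge; exact: num_real.
have VM : V t <= M := nincr_of_derive_le0 dV V_le T1 Tt.
have M0 : 0 <= M by rewrite mulr_ge0 ?expR_ge0.
rewrite -(@ler_pXn2r _ 2) ?nnegrE ?mulr_ge0 ?sqrtr_ge0 ?expR_ge0//.
rewrite (le_trans (sqr_norm_le_energy t))// exprMn sqr_sqrtr// -expRM_natl.
have -> : 2 * (- (m / 2) * t) = - (m * t) by field.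
by rewrite expRN ler_pdivlMr ?expR_gt0// mulrC.
Unshelve. all: by end_near. Qed.

(** From [- K energy <= energy'].  It is stated on an interval where the
    solution is small, because it serves both near a hypothetical zero and near
    infinity. *)
Let energy_lower : exists r' K, [/\ 0 < r', 0 < K &
  forall s t, 0 < s -> s <= t -> (forall x, s < x -> x < t -> `|z x| <= r') ->
    expR (K * s) * energy s <= expR (K * t) * energy t].
Proof.
have [r' r'0 fsmall] := forcing_small (@ltr01 R).
pose S := \sum_i a i; pose K := 2 * S + 2 * d%:R + 1.
have S0 : 0 <= S by apply: sumr_ge0 => i _; exact/ltW/a_gt0.
have aS i : a i <= S.
  by rewrite /S (bigD1 i)//= lerDl sumr_ge0// => j _; exact/ltW/a_gt0.
exists r', K; split=> //; first by rewrite ltr_wpDl// addr_ge0// mulr_ge0.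
move=> s t s0 st zx.
pose V t := expR (K * t) * energy t.
have dV (x : R) : 0 < x ->
    is_derive x (1 : R) V (expR (K * x) * (denergy x + K * energy x)).
  move=> x0; have ? := is_derive_energy x0.
  have ? := is_derive_expRM K x.
  apply: is_derive_eq.
  rewrite -[LHS]/(expR (K * x) * denergy x + energy x * (K * expR (K * x))).
  by ring.
rewrite -/(V s) -/(V t); refine (@ger0_derive1_ndecr R V s t _ _ _ s t (lexx s) st (lexx t)).
- move=> x; rewrite in_itv/= => /andP[sx _].
  by have [] := dV _ (lt_trans s0 sx).
- move=> x; rewrite in_itv/= => /andP[sx xt].
  have ? := dV _ (lt_trans s0 sx); rewrite derive1E derive_val.
  rewrite mulr_ge0 ?expR_ge0//.
  have := denergy_le ler01 (fsmall _ (zx _ sx xt)).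
  rewrite ler_norml => /andP[+ _].
  have : \sum_i 2 * a i * z x i 0 ^+ 2 <= 2 * S * energy x.
    rewrite mulr_sumr; apply: ler_sum => i _.
    by rewrite ler_wpM2r ?sqr_ge0// ler_wpM2l.
  have := energy_ge0 x; rewrite /K; nra.
- apply: derivable_within_continuous => x; rewrite in_itv/= => /andP[sx _].
  by have [] := dV _ (lt_le_trans s0 sx).
Qed.

(** At a first zero the lower bound for the energy, applied from a slightly
    earlier time, would be violated. *)
Let z_neq0 t : 0 < t -> z t <> 0.
Proof.
move=> t1_gt0 zt1; pose Z := [set s | 0 < s /\ z s = 0].
have [e /= e0 zstart] : \forall t \near (0 : R)^'+, z t <> 0 := z_start.
have lbZ : lbound Z e.
  move=> s [s0 zs0]; rewrite leNgt; apply/negP => se.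
  by apply: (zstart s _ s0) => //=; rewrite sub0r normrN gtr0_norm.
have hZ : has_inf Z by split; [exists t|exists e].
pose t0 := inf Z.
have t0_gt0 : 0 < t0 by rewrite (lt_le_trans e0)// lb_le_inf//; exists t.
have Econt : {for t0, continuous energy}.
  apply: differentiable_continuous; apply/derivable1_diffP.
  by have [] := is_derive_energy t0_gt0.
have znorm : energy x @[x --> t0] --> energy t0 by exact: Econt.
have Et0 : energy t0 = 0.
  apply/eqP; apply/negPn/negP => En0.
  have E_gt0 : 0 < energy t0 by rewrite lt_def En0 energy_ge0.
  have [d' /= d'0 Hd'] : \forall x \near t0, 0 < energy x.
    by apply: (cvgr_gt _ znorm).
  have [s [s0 zs0] st] := inf_adherent d'0 hZ.
  have t0s : t0 <= s by apply: ge_inf => //; exists e.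
  have := Hd' s; rewrite /= distrC ger0_norm ?subr_ge0//.
  rewrite ltrBlDl => /(_ st).
  rewrite /energy big1 ?ltxx// => i _.
  by rewrite zs0 mxE expr0n.
have [r' [K [r'0 K0 lower]]] := energy_lower.
have r2 : 0 < r' ^+ 2 by rewrite exprn_gt0.
have [d' /= d'0 Hd'] : \forall x \near t0, energy x < r' ^+ 2.
  by apply: (cvgr_lt _ znorm); rewrite Et0.
pose s := Num.max (t0 - d' / 2) (t0 / 2).
have st : s < t0.
  by rewrite gt_max ltrBlDr ltrDl divr_gt0//= gtr_pMr// invf_lt1// ltr1n.
have s0 : 0 < s by rewrite lt_max orbC divr_gt0.
have zs : z s <> 0.
  move=> zs0; have : t0 <= s by apply: ge_inf => //; exists e.
  by rewrite leNgt st.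
have := lower s t0 s0 (ltW st); rewrite Et0 mulr0 leNgt.
rewrite mulr_gt0 ?expR_gt0 ?energy_gt0//=; apply/not_implyP; split=> //.
move=> x sx xt; rewrite -(@ler_pXn2r _ 2) ?nnegrE ?(ltW r'0)//.
rewrite (le_trans (sqr_norm_le_energy x))// ltW// Hd'//=.
rewrite gtr0_norm ?subr_gt0//.
have : t0 - d' / 2 < x by rewrite (le_lt_trans _ sx)// le_max lexx.
lra.
Qed.

(** The energy would decay at rate [K + K] and yet exceed a positive multiple
    of [exp (- K t)]. *)
Let not_decays_fast : exists2 K, 0 < K & ~ decays K z.
Proof.
have [r' [K [r'0 K0 lower]]] := energy_lower.
have [T T0 zT] := near_small r'0.
exists K => // dz2.
have T1 : T < T + 1 by rewrite ltrDl.
pose M := expR (K * (T + 1)) * energy (T + 1).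
have M0 : 0 < M.
  by rewrite mulr_gt0 ?expR_gt0// energy_gt0//; apply: z_neq0; rewrite addr_gt0.
have dE : decays (K + K) energy.
  have dzi i := (decays_coordP K z).1 dz2 i.
  apply: decays_sum => i _ _; exact: decaysM (dzi i) (dzi i).
suff M00 : M = 0 by move: M0; rewrite M00 ltxx.
have KK : K < K + K by rewrite ltrDl.
apply: (decays_exp_coef0 KK); apply: (decays_dominated (K := 1) dE); near=> t.
have Tt : T + 1 <= t by near: t; apply: nbhs_pinfty_ge; exact: num_real.
rewrite mul1r !ger0_norm ?mulr_ge0 ?expR_ge0 ?(ltW M0)//.
rewrite mulNr expRN ler_pdivrMr ?expR_gt0// [leRHS]mulrC.
apply: lower; rewrite ?addr_gt0// => x Tx _.
by apply: zT; rewrite (lt_trans T1).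
Unshelve. all: by end_near. Qed.

Let forcing_decays s : 0 < s -> decays s z -> decays (b * s) f.
Proof.
move=> s0 ds.
have [T T0 zT] := near_small r_gt0.
have b0 : 0 <= b by rewrite (le_trans ler01)// ltW.
apply: (decays_powR (C := C) b0 ds); near=> t; apply/f_le/zT.
by near: t; apply: nbhs_pinfty_gt; exact: num_real.
Unshelve. all: by end_near. Qed.

(** One step of the bootstrap: a decay rate [s] of the solution gives the rate
    [b * s] of the forcing term, hence every coordinate is a pure exponential
    up to an error of a rate improved by the fixed factor [(1 + b) / 2]. *)
Let bootstrap_step s : 0 < s -> decays s z ->
  decays ((1 + b) / 2 * s) z \/
  exists i (c : 'cV[R]_d), [/\ c <> 0, forall j, c j 0 != 0 -> a j = a i &
    exists2 e, 0 < e & decays (a i + e) (fun t => z t - expR (- a i * t) *: c)].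
Proof.
move=> s0 ds; pose k := (1 + b) / 2 * s.
have kb : k < b * s.
  by rewrite ltr_pM2r// ltr_pdivrMr// mulrC mulr_natl mulr2n ltrD2r.
have /choice[c dc] : forall i, exists c,
    decays k (fun t => z t i 0 - c * expR (- a i * t)).
  move=> i; apply: (scalar_asymptotics kb _ ((decays_coordP _ _).1
    (forcing_decays s0 ds) i)).
  near=> t; apply: dz; near: t; apply: nbhs_pinfty_gt; exact: num_real.
have dsmall j : c j = 0 \/ k <= a j -> decays k (fun t => z t j 0).
  move=> cj; have : decays k (fun t => c j * expR (- a j * t)).
    case: cj => [->|kaj].
      by apply: decays_eq (decays0 _); near=> t; rewrite mul0r.
    apply: (decays_weaken kaj); have := decaysM (decays_cst (c j)) (decays_expR (a j)).
    by rewrite add0r.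
  move=> /(decaysD (dc j)); apply: decays_eq; near=> t; exact: subrK.
have [[i0 /andP[ci0 ai0]]|none] := pselect (exists i, (c i != 0) && (a i < k));
  last first.
  left; apply/decays_coordP => j; apply: dsmall.
  have [cj|cj] := eqVneq (c j) 0; [by left|right].
  by rewrite leNgt; apply/negP => ak; apply: none; exists j; rewrite cj.
right.
have [i /andP[ci ai] imin] := @arg_minP _ R 'I_d i0
  (fun i => (c i != 0) && (a i < k)) a (introT andP (conj ci0 ai0)).
exists i, (\col_j (if a j == a i then c j else 0)); split.
- move=> /matrixP/(_ i 0); rewrite !mxE eqxx => /eqP; exact/negP.
- by move=> j; rewrite mxE; have [//|_] := eqVneq (a j) (a i); rewrite eqxx.
(* The coordinates with eigenvalue [a i] lose their leading term and decay at
   rate [k]; another coordinate decays at rate [k] or carries an exponential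
   with a larger eigenvalue. *)
pose rate j := if a i < a j then Num.min k (a j) else k.
have [e e0 erate] : exists2 e, 0 < e & forall j, a i + e <= rate j.
  apply: finite_gap => j; rewrite /rate; case: ifPn => // aij.
  by rewrite lt_min ai.
exists e => //; apply/decays_coordP => j; apply: (decays_weaken (erate j)).
have [aj|aj] := eqVneq (a j) (a i).
  rewrite /rate aj ltxx; apply: decays_eq (dc j); near=> t.
  by rewrite !mxE aj eqxx mulrC.
have -> : (fun t => (z t - expR (- a i * t) *: (\col_j (if a j == a i then c j else 0))) j 0)
    = (fun t => z t j 0).
  by apply/funext => t; rewrite !mxE (negbTE aj) mulr0 subr0.
have [cj|cj] := eqVneq (c j) 0.
  apply: decays_weaken (dsmall _ (or_introl cj)); rewrite /rate.
  by case: ifP => // _; rewrite ge_min lexx.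
have [kaj|ajk] := leP k (a j).
  apply: decays_weaken (dsmall _ (or_intror kaj)); rewrite /rate.
  by case: ifP => // _; rewrite ge_min lexx.
have aij : a i < a j by rewrite lt_def aj imin// cj ajk.
have dcj : decays (rate j) (fun t => c j * expR (- a j * t)).
  have := decaysM (decays_cst (c j)) (decays_expR (a j)); rewrite add0r.
  by apply: decays_weaken; rewrite /rate aij ge_min lexx orbT.
have := decaysD (decays_weaken _ (dc j)) dcj.
have rk : rate j <= k by rewrite /rate aij ge_min lexx.
move=> /(_ rk); apply: decays_eq; near=> t; exact: subrK.
Unshelve. all: by end_near. Qed.

(** Since the solution cannot decay faster than every exponential, the
    bootstrap stops at a nonzero coefficient. *)
Theorem leading_exponential :
  exists i (c : 'cV[R]_d), [/\ c <> 0, forall j, c j 0 != 0 -> a j = a i &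
    exists2 e, 0 < e & decays (a i + e) (fun t => z t - expR (- a i * t) *: c)].
Proof.
have [s s0 ds] := solution_decays; have [K K0 nK] := not_decays_fast.
pose k := (1 + b) / 2.
have k1 : 1 < k by rewrite ltr_pdivlMr// mul1r -[2]/(1 + 1) ltrD2l.
have k0 : 0 < k by rewrite (lt_trans ltr01).
apply: contrapT => none.
have dn n : decays (s * k ^+ n) z.
  elim: n => [|n ih]; first by rewrite expr0 mulr1.
  have := bootstrap_step (mulr_gt0 s0 (exprn_gt0 n k0)) ih.
  by case=> // ds'; rewrite exprS mulrCA.
have [n Kn] := geometric_exceeds K s0 k1.
by apply: nK; exact: decays_weaken Kn (dn n).
Qed.

End PerturbedDiagonal.

(** * Homogeneous maps and the superlinearity of the nonlinear term *)

Section Homogeneous.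
Context {R : realType} {d : nat}.
Implicit Types (G : 'cV[R]_d -> 'cV[R]_d) (x : 'cV[R]_d).

Lemma trmx_norm (m n : nat) (M : 'M[R]_(m, n)) : `|M^T| = `|M|.
Proof.
suff le p q (N : 'M[R]_(p, q)) : `|N^T| <= `|N|.
  by apply/eqP; rewrite eq_le le -{1}(trmxK M) le.
rewrite [leLHS]/Num.norm/= mx_normrE bigmax_le// => -[i j] _.
by rewrite mxE [leRHS]/Num.norm/= mx_normrE; exact: (le_bigmax _ _ (j, i)).
Qed.

Lemma continuous_trmx (m n : nat) : continuous (@trmx R m n).
Proof.
move=> M s /= /(nbhs_ballP M^T) [e e0 es].
apply/nbhs_ballP; exists e => //= N [_ MN]; apply: es; split=> // i j.
by rewrite !mxE.
Qed.

(** Compactness of the unit sphere turns homogeneity into a global bound. *)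
Lemma homogeneous_bound beta G : 0 < beta -> homogeneous beta G ->
  (forall x, x <> 0 -> {for x, continuous G}) ->
  exists2 C, 0 <= C & forall x, `|G x| <= C * `|x| `^ beta.
Proof.
move=> b0 hG cG.
have G0 : G 0 = 0.
  have /eqP := hG 0 2 (ltr0n R 2).
  rewrite scaler0 -{1}[G 0]scale1r -subr_eq0 -scalerBl scaler_eq0 subr_eq0.
  rewrite eq_sym powR_eq1 gt_eqF ?ltr1n//= (gt_eqF b0) orbF.
  by rewrite ltNge ler0n/= => /eqP.
pose S := [set v : 'rV[R]_d | `|v| = 1].
suff [C C0 CS] : exists2 C, 0 <= C & forall v : 'rV[R]_d, S v -> `|G v^T| <= C.
  exists C => // x; have [->|x0] := eqVneq x 0.
    by rewrite G0 normr0 mulr_ge0 ?powR_ge0.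
  have nx : 0 < `|x| by rewrite normr_gt0.
  have -> : G x = `|x| `^ beta *: G ((`|x|^-1 *: x)^T)^T.
    by rewrite trmxK -hG// scalerA mulfV ?gt_eqF// scale1r.
  rewrite normrZ ger0_norm ?powR_ge0// mulrC ler_wpM2r ?powR_ge0//.
  apply: CS; rewrite /S/= trmx_norm normrZ normfV normr_id mulVf ?gt_eqF//.
have [[v Sv]|Sempty] := pselect (exists v, S v); last first.
  by exists 0 => // v Sv; exfalso; apply: Sempty; exists v.
have cS : compact S.
  apply: bounded_closed_compact.
    by exists 1; split; [exact: num_real|move=> M M1 w /= ->; exact: ltW].
  apply: (closed_comp (f := fun v : 'rV[R]_d => `|v|) (D := [set 1])).
    by move=> w _; exact: norm_continuous.
  exact: closed_eq.
have cG' : {within S, continuous (fun w : 'rV[R]_d => `|G w^T|)}.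
  apply: continuous_in_subspaceT => w; rewrite inE => Sw.
  apply: (@continuous_comp _ _ _ (fun w : 'rV[R]_d => G w^T) (fun x => `|x|));
    last exact: norm_continuous.
  apply: continuous_comp; first exact: continuous_trmx.
  apply: cG => wT0; move: Sw; rewrite /S/= -trmx_norm wT0 normr0 => /eqP.
  by rewrite eq_sym oner_eq0.
have [w _ wmax] := EVT_max_rV (ex_intro _ v Sv) cS cG'.
by exists `|G w^T| => // u Su; apply: wmax; rewrite inE.
Qed.

Lemma powR_nonincreasing (x p q : R) : 0 <= x <= 1 -> 0 < p -> p <= q ->
  x `^ q <= x `^ p.
Proof.
move=> /andP[x0 x1] p0 pq; have [->|xn0] := eqVneq x 0.
  by rewrite !powR0 ?gt_eqF// (lt_le_trans p0).
by apply: ger_powR => //; rewrite lt_def xn0 x0.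
Qed.

Lemma bigO_near_norm (p : R) G : 0 <= p ->
  bigO_at (nbhs (0 : 'cV[R]_d)) (fun x => enorm (G x)) (fun x => enorm x `^ p) ->
  exists C, 0 <= C /\ exists2 r, 0 < r &
    forall x, `|x| <= r -> `|G x| <= C * `|x| `^ p.
Proof.
move=> p0 [C [C0 /nbhs_norm0P[r /= r0 Gr]]].
exists (C * Num.sqrt d%:R `^ p); split; first by rewrite mulr_ge0 ?powR_ge0 ?ltW.
exists (r / 2); first by rewrite divr_gt0.
move=> x xr; have xr' : `|x| < r.
  by rewrite (le_lt_trans xr)// gtr_pMr// invf_lt1// ltr1n.
have := Gr x xr'; rewrite /= ger0_norm ?enorm_ge0// => h.
rewrite (le_trans (norm_le_enorm _))// (le_trans h)// -mulrA ler_pM2l//.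
rewrite -powRM ?sqrtr_ge0//; apply: ge0_ler_powR => //.
- by rewrite nnegrE enorm_ge0.
- by rewrite nnegrE mulr_ge0// sqrtr_ge0.
- exact: enorm_le_norm.
Qed.

End Homogeneous.

(** * The leading exponential of a decaying solution *)

Section Solution.
Context {R : realType} {d : nat}.
Implicit Types (y : R -> 'cV[R]_d) (x : 'cV[R]_d).

(** The rows of [P] are left eigenvectors of [A]. *)
Lemma diagonalizable_eigenbasis (A : 'M[R]_d) : diagonalizable A ->
  exists (P : 'M[R]_d) (a : 'I_d -> R), [/\ P \in unitmx,
    forall i x, (P *m (A *m x)) i 0 = a i * (P *m x) i 0 &
    forall i, eigenvalue A (a i)].
Proof.
move=> [P Punit] /diagonalizable_forPex[D].
move=> /(simmxP Punit) PA; exists P, (fun i => D 0 i); split=> //.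
  by move=> i x; rewrite mulmxA PA -mulmxA mul_diag_mx mxE.
move=> i; apply/eigenvalueP; exists (row i P).
  by rewrite -row_mul PA row_mul row_diag_mx -scalemxAl -rowE.
apply/eqP => Pi0.
have := congr1 (fun M => M *m invmx P) Pi0.
rewrite -row_mul mulmxV// mul0mx => /matrixP/(_ 0 i).
by rewrite !mxE eqxx => /eqP; rewrite oner_eq0.
Qed.

(** The restriction to nonnegative times is void for increments smaller than
    [t]. *)
Lemma C1_halfline_derivable y (t : R) :
  C1_halfline y -> 0 < t -> derivable y t 1.
Proof.
move=> [dy [_ ydy]] t0; have ydt := ydy t (ltW t0).
apply/cvg_ex; exists (dy t); apply/cvgrPdist_le => e e0.
have [/= r r0 yr] := (cvgrPdist_le _ _).1 ydt e e0.
exists (Num.min r t) => /=; first by rewrite lt_min r0.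
move=> h; rewrite /= sub0r normrN lt_min => /andP[hr ht] h0.
have := yr (h + t); rewrite /= opprD addrA addrAC subrr sub0r normrN addrK.
rewrite [h%:A]mulr1; apply => //.
  by rewrite -subr_eq0 addrK.
by rewrite -lerBlDr sub0r; move: ht; rewrite ltr_norml => /andP[/ltW].
Qed.

Lemma C1_halfline_start y : C1_halfline y -> y s @[s --> (0 : R)^'+] --> y 0.
Proof.
move=> [dy [_ ydy]]; have yd0 := ydy 0 (lexx 0).
have q : s^-1 *: (y s - y 0) @[s --> (0 : R)^'+] --> dy 0.
  apply/cvgrPdist_le => e e0.
  have [/= r r0 yr] := (cvgrPdist_le _ _).1 yd0 e e0.
  exists r => //= s sr s0; have := yr s sr; rewrite subr0; apply.
    by rewrite gt_eqF.
  exact: ltW.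
have s0 : s @[s --> (0 : R)^'+] --> (0 : R) by exact: cvg_at_right_filter.
have h : s *: (s^-1 *: (y s - y 0)) + y 0 @[s --> (0 : R)^'+] --> 0 *: dy 0 + y 0.
  by apply: cvgD; [exact: cvgZ|exact: cvg_cst].
rewrite scale0r add0r in h.
apply/cvgrPdist_le => e e0; have [/= r r0 yr] := (cvgrPdist_le _ _).1 h e e0.
exists r => //= s sr s_gt0; have := yr s sr s_gt0.
by rewrite /= scalerA mulfV ?gt_eqF// scale1r subrK.
Qed.

Lemma is_derive_coord y t (M : 'M[R]_d) i : derivable y t 1 ->
  is_derive t (1 : R) (fun s => (M *m y s) i 0) ((M *m y^`()%classic t) i 0).
Proof.
move=> dy; have dyj j : is_derive t (1 : R) (fun s => y s j 0) (y^`()%classic t j 0).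
  apply: DeriveDef; first exact: (derivable_mxP y t 1).1 dy j 0.
  by rewrite derive1E (derive_mx dy) mxE.
have -> : (fun s => (M *m y s) i 0) = \sum_j (fun s => M i j *: y s j 0).
  by apply/funext => s; rewrite mxE fct_sumE.
rewrite mxE; apply: is_derive_sum => j; exact: is_deriveZ.
Qed.

Lemma linear_image_cvg0 (M : 'M[R]_d) y :
  y t @[t --> +oo] --> (0 : 'cV[R]_d) -> M *m y t @[t --> +oo] --> (0 : 'cV[R]_d).
Proof.
have [K K0 MK] := norm_mulmx_le M.
move=> ylim; apply/norm_cvg0P.
have h : K * `|y t| @[t --> +oo] --> K * `|0 : 'cV[R]_d|.
  by apply: cvgMl_tmp; exact: cvg_norm.
rewrite normr0 mulr0 in h; apply: (squeeze_cvgr _ (cvg_cst 0) h).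
by near=> t; rewrite normr_ge0/= MK.
Unshelve. all: by end_near. Qed.

Theorem leading_asymptotics (A P : 'M[R]_d) (a : 'I_d -> R)
    (F : 'cV[R]_d -> 'cV[R]_d) (r b C : R) y :
  P \in unitmx -> (forall i x, (P *m (A *m x)) i 0 = a i * (P *m x) i 0) ->
  (forall i, 0 < a i) ->
  0 < r -> 1 < b -> 0 <= C -> (forall x, `|x| <= r -> `|F x| <= C * `|x| `^ b) ->
  C1_halfline y -> (forall t, 0 < t -> y^`()%classic t + A *m y t = F (y t)) ->
  y 0 <> 0 -> y t @[t --> +oo] --> (0 : 'cV[R]_d) ->
  exists i xi, [/\ xi <> 0, A *m xi = a i *: xi &
    exists2 e, 0 < e & decays (a i + e) (fun t => y t - expR (- a i * t) *: xi)].
Proof.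
move=> Pu PA a0 r0 b1 C0 FC C1 ode y0 ylim.
pose z t := P *m y t; pose f t := P *m F (y t).
have yz t : y t = invmx P *m z t by rewrite /z mulKmx.
have [K K0 PK] := norm_mulmx_le P.
have [L L0 PL] := norm_mulmx_le (invmx P).
have dz (t : R) i : 0 < t ->
    is_derive t (1 : R) (fun s => z s i 0) (f t i 0 - a i * z t i 0).
  move=> t0; have dy := C1_halfline_derivable C1 t0.
  have := is_derive_coord P i dy.
  have -> : y^`()%classic t = F (y t) - A *m y t by rewrite -ode// addrK.
  by rewrite mulmxBr mxE [X in _ + X]mxE PA.
have rL : 0 < r / L by rewrite divr_gt0.
have fle t : `|z t| <= r / L -> `|f t| <= (K * (C * L `^ b)) * `|z t| `^ b.
  move=> zr; rewrite /f (le_trans (PK _))// -mulrA ler_pM2l//.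
  have yL : `|y t| <= L * `|z t| by rewrite yz PL.
  have yr : `|y t| <= r by rewrite (le_trans yL)// -ler_pdivlMl// mulrC.
  rewrite (le_trans (FC _ yr))// -mulrA ler_wpM2l// -powRM ?(ltW L0)//.
  apply: ge0_ler_powR; rewrite ?nnegrE ?mulr_ge0 ?(ltW L0)//.
  by rewrite (le_trans ler01)// ltW.
have zlim : z t @[t --> +oo] --> (0 : 'cV[R]_d) by exact: linear_image_cvg0.
have zstart : \forall t \near (0 : R)^'+, z t <> 0.
  have yn0 : \forall t \near (0 : R)^'+, y t != 0.
    exact: cvgr_neq0 (C1_halfline_start C1) (introN eqP y0).
  apply: filterS yn0 => t /eqP yt zt; apply: yt.
  by rewrite yz zt mulmx0.
have [i [c [c0 ca [e e0 de]]]] :=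
  leading_exponential a0 dz rL b1 fle zlim zstart.
exists i, (invmx P *m c); split.
- move=> Pc0; apply: c0; rewrite -(mulKVmx Pu c) Pc0 mulmx0.
- by [].
- apply: (can_inj (mulKmx Pu)); apply/colP => j.
  rewrite PA -scalemxAr mulKVmx// mxE.
  by have [->|/ca ->//] := eqVneq (c j 0) 0; rewrite !mulr0.
- exists e => //; apply: decays_eq (decays_mulmx (invmx P) de).
  by near=> t; rewrite mulmxBr -scalemxAr -yz.
Unshelve. all: by end_near. Qed.

End Solution.

(** * Multilinearity of higher derivatives and Taylor's formula *)

Section HigherDerivatives.
Context {R : realType} {d : nat}.
Implicit Types (G : 'cV[R]_d -> 'cV[R]_d) (U : set 'cV[R]_d).
Implicit Types (pre post vs : seq 'cV[R]_d) (u v x xi : 'cV[R]_d).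

Lemma mderive_consE G vs w x : differentiable (mderive G vs) x ->
  mderive G (w :: vs) x = 'D_w (mderive G vs) x.
Proof. by move=> dG; exact: esym (deriveE w dG). Qed.

(** The identity holds on a neighbourhood of [x], so it can be differentiated in
    the directions that stand to the left of the argument. *)
Lemma mderive_linear G U pre post (a : R) u v x :
  open U -> smooth_on U G -> U x ->
  mderive G (pre ++ (a *: u + v) :: post) x =
  a *: mderive G (pre ++ u :: post) x + mderive G (pre ++ v :: post) x.
Proof.
move=> oU sG; elim: pre x => [|w pre ih] x Ux; first by rewrite /= linearP.
have dif vs : differentiable (mderive G vs) x by exact: sG.
have der vs : derivable (mderive G vs) x w by exact: diff_derivable.
rewrite !cat_cons (mderive_consE w (dif (pre ++ (a *: u + v) :: post))).
rewrite (mderive_consE w (dif (pre ++ u :: post))).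
rewrite (mderive_consE w (dif (pre ++ v :: post))).
have -> : 'D_w (mderive G (pre ++ (a *: u + v) :: post)) x =
    'D_w (a *: mderive G (pre ++ u :: post) + mderive G (pre ++ v :: post)) x.
  apply: near_eq_derive.
  have : \forall z \near x, U z by exact: open_nbhs_nbhs.
  by apply: filterS => z Uz; exact: ih.
by rewrite deriveD ?deriveZ//; exact: derivableZ.
Qed.

Lemma mderive_sum (I : Type) (r : seq I) G U pre post (c : I -> R)
    (v : I -> 'cV[R]_d) x : open U -> smooth_on U G -> U x ->
  mderive G (pre ++ (\sum_(i <- r) c i *: v i) :: post) x =
  \sum_(i <- r) c i *: mderive G (pre ++ v i :: post) x.
Proof.
move=> oU sG Ux; elim: r => [|i r ih].
  (* [0 = - 1 *: 0 + 0] shows that a zero argument gives zero. *)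
  have := mderive_linear pre post (- 1) 0 0 oU sG Ux.
  by rewrite !big_nil scaler0 addr0 scaleN1r addNr.
by rewrite !big_cons (mderive_linear _ _ _ _ _ oU sG Ux) ih.
Qed.

Lemma col_sum_delta x : x = \sum_i x i 0 *: delta_mx i 0.
Proof.
rewrite {1}(matrix_sum_delta x); apply: eq_bigr => i _.
by rewrite big_ord1.
Qed.

(** Expanding every argument in the standard basis reduces the bound to the
    continuity of finitely many functions. *)
Lemma mderive_locally_bounded G U pre m xi : open U -> smooth_on U G -> U xi ->
  exists2 C, 0 <= C & \forall x \near xi, forall vs, size vs = m ->
    `|mderive G (pre ++ vs) x| <= C * \prod_(v <- vs) `|v|.
Proof.
move=> oU sG Uxi; elim: m pre => [|m ih] pre.
  exists (`|mderive G pre xi| + 1); first exact: addr_ge0.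
  have cG : mderive G pre x @[x --> xi] --> mderive G pre xi.
    by apply: differentiable_continuous; exact: sG.
  have nG : \forall x \near xi, `|mderive G pre x| < `|mderive G pre xi| + 1.
    by apply: (cvgr_norm_lt _ cG); rewrite ltrDl.
  apply: filterS nG => x /ltW Gx [|//] _.
  by rewrite cats0 big_nil mulr1.
have /choice[C HC] : forall i : 'I_d, exists C, 0 <= C /\ \forall x \near xi, forall vs,
    size vs = m ->
    `|mderive G (rcons pre (delta_mx i 0) ++ vs) x| <= C * \prod_(v <- vs) `|v|.
  by move=> i; have [C C0 HC] := ih (rcons pre (delta_mx i 0)); exists C.
exists (\sum_i C i); first by apply: sumr_ge0 => i _; case: (HC i).
have nU : \forall z \near xi, U z by exact: open_nbhs_nbhs.
have nC : \forall x \near xi, forall i vs, size vs = m ->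
    `|mderive G (rcons pre (delta_mx i 0) ++ vs) x| <= C i * \prod_(v <- vs) `|v|.
  exact: (filter_forall (nbhs_filter xi) (fun i => (HC i).2)).
apply: filterS2 nU nC => x Ux Cx [//|v vs] [szvs].
rewrite {1}(col_sum_delta v) (mderive_sum _ _ _ _ _ oU sG Ux).
rewrite (le_trans (ler_norm_sum _ _ _))// mulr_suml; apply: ler_sum => i _.
rewrite normrZ big_cons mulrCA ler_pM// ?coord_le_norm//.
by rewrite -cat_rcons; exact: Cx.
Qed.

(** The derivative of the remainder is the remainder of one order less of the
    derivative; the mean value theorem on the unit interval propagates the bound
    unchanged. *)
Lemma taylor_unit_interval (h : nat -> R -> R) n B :
  (forall m (s : R), (m < n)%N -> 0 <= s <= 1 ->
    is_derive s (1 : R) (h m) (h m.+1 s)) ->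
  (forall s, 0 <= s <= 1 -> `|h n s| <= B) ->
  forall s, 0 <= s <= 1 ->
    `|h 0 s - \sum_(m < n) s ^+ m / m`!%:R * h m 0| <= B.
Proof.
elim: n h => [|n ih] h dh hB s s01; first by rewrite big_ord0 subr0 hB.
pose p s := h 0%N s - \sum_(m < n.+1) s ^+ m / m`!%:R * h m 0.
pose p' s := h 1%N s - \sum_(m < n) s ^+ m / m`!%:R * h m.+1 0.
have dp (x : R) : 0 <= x <= 1 -> is_derive x (1 : R) p (p' x).
  move=> x01; have ? := dh 0%N x isT x01.
  apply: is_deriveB.
  have -> : (fun t : R => \sum_(m < n.+1) t ^+ m / m`!%:R * h m 0) =
     cst (h 0%N 0) + \sum_(m < n) (fun t : R => h m.+1 0 / m.+1`!%:R *: t ^+ m.+1).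
    apply/funext => t; rewrite /= big_ord_recl fct_sumE expr0 fact0 invr1 !mul1r.
    by congr (_ + _); apply: eq_bigr => m _; rewrite [RHS]mulrC mulrA mulrAC.
  rewrite -[X in is_derive _ _ _ X]add0r; apply: is_deriveD.
  apply: is_derive_sum => m.
  have d1 : is_derive x (1 : R) (fun t : R => t ^+ m.+1) (m.+1%:R * x ^+ m).
    by apply: DeriveDef; [exact: exprn_derivable|rewrite exp_derive scaler1 -mulr_natl].
  apply: is_derive_eq; rewrite -[LHS]/(_ * _) factS natrM.
  have m0 : m.+1%:R != 0 :> R by rewrite pnatr_eq0.
  have f0 : m`!%:R != 0 :> R by rewrite pnatr_eq0 -lt0n fact_gt0.
  move: m0 f0; move: (m.+1%:R : R) (m`!%:R : R) => a b a0 b0.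
  by field; rewrite a0 b0.
have p0 : p 0 = 0.
  rewrite /p big_ord_recl expr0 fact0 invr1 !mul1r big1 ?addr0 ?subrr// => m _.
  by rewrite expr0n/= !mul0r.
move: s01 => /andP[s0 s1].
have [x| |c] := @MVT_segment _ p p' 0 s s0.
- rewrite in_itv/= => /andP[x0 xs]; apply: dp.
  by rewrite (ltW x0) (le_trans (ltW xs)).
- apply: derivable_within_continuous => x; rewrite in_itv/= => /andP[x0 xs].
  by have [] := dp x _; rewrite ?x0 ?(le_trans xs).
rewrite in_itv/= => /andP[c0 cs]; rewrite p0 !subr0 -/(p s) => ->.
have c01 : 0 <= c <= 1 by rewrite c0 (le_trans cs).
have pc : `|p' c| <= B.
  apply: (ih (fun m => h m.+1)) => // m x mn x01; exact: dh.
by rewrite normrM (ger0_norm s0) (le_trans _ pc)// ler_piMr.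
Qed.

Lemma is_derive_line G (vs : seq 'cV[R]_d) x u i (s : R) :
  differentiable (mderive G vs) (x + s *: u) ->
  is_derive s (1 : R) (fun s => mderive G vs (x + s *: u) i 0)
    (mderive G (u :: vs) (x + s *: u) i 0).
Proof.
move=> dG; pose l (s : R) := x + s *: u.
have dl : is_diff s l ( *:%R^~ u).
  rewrite -[X in is_diff _ _ X]add0r; apply: is_diffD.
have dGl : is_diff s (mderive G vs \o l) ('d (mderive G vs) (l s) \o ( *:%R^~ u)).
  by apply: is_diff_comp; exact: DiffDef.
have der : derivable (mderive G vs \o l) s 1 by apply: diff_derivable.
apply: DeriveDef; first exact: (derivable_mxP _ _ _).1 der i 0.
have := derive_mx der; rewrite deriveE; last by [].
rewrite diff_val => /matrixP/(_ i 0); rewrite !mxE /= scale1r => <-.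
by [].
Qed.

(** Uniform in the base point: [n = 1] is a Lipschitz estimate around [xi], and
    larger [n] at [x = xi] is the Taylor formula.  A third of the radius is taken
    so that the whole segment from [x] to [x + u] stays in the ball. *)
Lemma mderive_taylor G U n xi : open U -> smooth_on U G -> U xi ->
  exists C r, [/\ 0 <= C, 0 < r & forall x u, `|x - xi| <= r -> `|u| <= r ->
    `|G (x + u) - \sum_(m < n) m`!%:R^-1 *: mderive G (nseq m u) x|
      <= C * `|u| ^+ n].
Proof.
move=> oU sG Uxi.
have [C C0 HC] := mderive_locally_bounded [::] n oU sG Uxi.
have nU : \forall z \near xi, U z by exact: open_nbhs_nbhs.
have [e /= e0 He] := (nbhs_normP _ _).1 (filterI nU HC).
exists C, (e / 3); split=> //; first by rewrite divr_gt0.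
move=> x u xxi ue.
have near_line (s : R) : 0 <= s <= 1 -> `|xi - (x + s *: u)| < e.
  move=> /andP[s0 s1]; rewrite opprD addrA (le_lt_trans (ler_normB _ _))//.
  rewrite normrZ (ger0_norm s0) distrC.
  have : s * `|u| <= `|u| by rewrite ler_piMl.
  move: xxi ue e0; lra.
apply: norm_le_of_coord => [|i]; first by rewrite mulr_ge0// exprn_ge0.
pose h m (s : R) := mderive G (nseq m u) (x + s *: u) i 0.
have dh m (s : R) : (m < n)%N -> 0 <= s <= 1 -> is_derive s (1 : R) (h m) (h m.+1 s).
  move=> _ s01; apply: is_derive_line; apply: sG.
  by have [] := He _ (near_line s s01).
have hB s : 0 <= s <= 1 -> `|h n s| <= C * `|u| ^+ n.
  move=> s01; have [_ /(_ (nseq n u))] := He _ (near_line s s01).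
  rewrite size_nseq big_nseq iter_mulr_1 => /(_ erefl).
  exact: le_trans (coord_le_norm _ _).
have := taylor_unit_interval dh hB (s := 1); rewrite ler01 lexx => /(_ isT).
rewrite /h/= scale1r scale0r addr0; congr (`|_| <= _).
rewrite mxE [in RHS]mxE summxE; congr (_ - _); apply: eq_bigr => m _.
by rewrite mxE expr1n mul1r.
Qed.

(** The tuples of length [m] over [r], as a list, so that multinomial expansions
    are ordinary iterated sums. *)
Fixpoint words (T : Type) (r : seq T) (m : nat) : seq (seq T) :=
  if m is m'.+1 then [seq k :: ks | k <- r, ks <- words r m'] else [:: [::]].

Lemma mem_words (T : eqType) (r : seq T) m (w : seq T) :
  (w \in words r m) = (size w == m) && all (mem r) w.
Proof.
elim: m w => [|m ih] [|k ks] //=; first by apply/allpairsP => -[[? ?] []].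
rewrite eqSS andbCA -ih; apply/allpairsP/andP => [[[k' w'] /= [k'r w'm [-> ->]]]|[]] //.
by move=> kr km; exists (k, ks).
Qed.

Lemma words_uniq (T : eqType) (r : seq T) m : uniq r -> uniq (words r m).
Proof.
move=> ur; elim: m => //= m ih.
by apply: allpairs_uniq => // -[k w] [k' w'] _ _ [-> ->].
Qed.

Lemma mderive_nseq_sum (I : Type) (r : seq I) G U pre m (c : I -> R)
    (v : I -> 'cV[R]_d) x : open U -> smooth_on U G -> U x ->
  mderive G (pre ++ nseq m (\sum_(i <- r) c i *: v i)) x =
  \sum_(ks <- words r m)
    (\prod_(k <- ks) c k) *: mderive G (pre ++ [seq v k | k <- ks]) x.
Proof.
move=> oU sG Ux; elim: m pre => [|m ih] pre.
  by rewrite big_seq1 big_nil scale1r.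
rewrite /= big_allpairs_dep (mderive_sum _ _ _ _ _ oU sG Ux).
apply: eq_bigr => k _; rewrite -cat_rcons ih scaler_sumr.
by apply: eq_bigr => ks _; rewrite big_cons scalerA cat_rcons.
Qed.

Lemma pevalE (q : 'cV[{poly R}]_d) t i : peval q t i 0 = (q i 0).[t].
Proof. by rewrite mxE. Qed.

Lemma pevalD (p q : 'cV[{poly R}]_d) t : peval (p + q) t = peval p t + peval q t.
Proof. by apply/colP => i; rewrite !mxE hornerD. Qed.

Lemma peval_sum (I : Type) (r : seq I) (q : I -> 'cV[{poly R}]_d) t :
  peval (\sum_(i <- r) q i) t = \sum_(i <- r) peval (q i) t.
Proof.
elim: r => [|i r ih]; last by rewrite !big_cons pevalD ih.
by rewrite !big_nil; apply/colP => i; rewrite !mxE horner0.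
Qed.

Lemma pevalZ (p : {poly R}) (q : 'cV[{poly R}]_d) t :
  peval (p *: q) t = p.[t] *: peval q t.
Proof. by apply/colP => i; rewrite !mxE hornerM. Qed.

(** Expanding one argument at a time in the standard basis moves it into the
    constant prefix [pre], with a scalar polynomial as coefficient. *)
Lemma mderive_peval G U pre (ks : seq nat) (q : nat -> 'cV[{poly R}]_d) x :
  open U -> smooth_on U G -> U x ->
  exists p : 'cV[{poly R}]_d, forall t,
    mderive G (pre ++ [seq peval (q k) t | k <- ks]) x = peval p t.
Proof.
move=> oU sG Ux; elim: ks pre => [|k ks ih] pre.
  exists (map_mx polyC (mderive G pre x)) => t.
  by apply/colP => i; rewrite cats0 pevalE mxE hornerC.
have /choice[p Hp] : forall i : 'I_d, exists p : 'cV[{poly R}]_d, forall t,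
    mderive G (rcons pre (delta_mx i 0) ++ [seq peval (q k) t | k <- ks]) x
    = peval p t by move=> i; exact: ih.
exists (\sum_i q k i 0 *: p i) => t; rewrite peval_sum /=.
rewrite {1}(col_sum_delta (peval (q k) t)) (mderive_sum _ _ _ _ _ oU sG Ux).
by apply: eq_bigr => i _; rewrite pevalZ -Hp cat_rcons pevalE.
Qed.

End HigherDerivatives.

(** * Enumeration of the exponents *)

Section Enumeration.
Context {R : realType}.
Implicit Types (S T : set R) (B g s : R).

Definition locally_finite S := forall B, finite_set (S `&` [set s | s <= B]).

Lemma locally_finite_multiples g : 0 <= g ->
  locally_finite [set n%:R * g | n in [set: nat]].
Proof.
rewrite le_eqVlt => /predU1P[<-|g0] B.
  apply: (sub_finite_set (B := [set 0])); last exact: finite_set1.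
  by move=> _ [[n _ <-] _]; rewrite mulr0.
pose N := (Num.truncn `|B / g|).+1.
apply: (sub_finite_set (B := (fun n : nat => n%:R * g) @` `I_N)).
  move=> _ [[n _ <-] /= nB]; exists n => //=.
  rewrite -(ltr_nat R) (le_lt_trans _ (truncnS_gt _))//.
  by rewrite (le_trans _ (ler_norm _))// ler_pdivlMr.
exact/finite_image/finite_II.
Qed.

(** Since both terms are nonnegative, each is bounded by the sum. *)
Lemma locally_finite_sum S T : (forall s, S s -> 0 <= s) ->
  (forall s, T s -> 0 <= s) -> locally_finite S -> locally_finite T ->
  locally_finite [set s | exists x y, [/\ S x, T y & s = x + y]].
Proof.
move=> S0 T0 fS fT B.
apply: (sub_finite_set (B := (fun xy : R * R => xy.1 + xy.2) @`
   ((S `&` [set s | s <= B]) `*` (T `&` [set s | s <= B])))).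
  move=> _ [[x [y [Sx Ty ->]]] /= xyB]; exists (x, y) => //=; split; split=> //=.
    by rewrite (le_trans _ xyB)// lerDl T0.
  by rewrite (le_trans _ xyB)// lerDr S0.
by apply: finite_image; apply: finite_setX.
Qed.

Lemma locally_finite_combinations (r : seq nat) (g : nat -> R) :
  (forall k, k \in r -> 0 <= g k) ->
  locally_finite [set s | exists m : nat -> nat, s = \sum_(k <- r) (m k)%:R * g k].
Proof.
elim: r => [|k r ih] g0.
  move=> B; apply: (sub_finite_set (B := [set 0])); last exact: finite_set1.
  by move=> s [[m ->] _] /=; rewrite big_nil.
have gk : 0 <= g k by rewrite g0// mem_head.
have gr i : i \in r -> 0 <= g i by move=> ir; rewrite g0// in_cons ir orbT.
have f0 := locally_finite_sum _ _ (locally_finite_multiples gk) (ih gr).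
move=> B; apply: sub_finite_set (f0 _ _ B).
- move=> s [[m ->] sB]; split=> //=; exists ((m k)%:R * g k), (\sum_(k <- r) (m k)%:R * g k).
  by rewrite big_cons; split=> //; [exists (m k)|exists m].
- by move=> _ [n _ <-]; rewrite mulr_ge0.
- move=> _ [m ->]; rewrite big_seq; apply: sumr_ge0 => i ir.
  by rewrite mulr_ge0// gr.
Qed.

Lemma seq_min (r : seq R) : r != [::] ->
  exists2 m, m \in r & forall y, y \in r -> m <= y.
Proof.
elim: r => // x [|z r] ih _.
  by exists x; rewrite ?mem_head// => y; rewrite inE => /eqP ->.
have [m mr mmin] := ih isT; have [xm|/ltW mx] := leP x m.
  exists x; first exact: mem_head.
  move=> y; rewrite in_cons => /predU1P[-> //|yr].
  by rewrite (le_trans xm)// mmin.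
exists m; first by rewrite in_cons mr orbT.
by move=> y; rewrite in_cons => /predU1P[-> //|]; exact: mmin.
Qed.

(** Repeatedly taking the least element above the current one exhausts the set:
    an omitted element would exceed infinitely many others. *)
Lemma locally_finite_enumeration S : locally_finite S ->
  S 0 -> (forall s, S s -> 0 <= s) -> (forall B, exists2 s, S s & B < s) ->
  exists2 mut : nat -> R, mut 1%N = 0 & increasing_enumeration mut S.
Proof.
move=> fS S0 Spos Sunb.
have /choice[next nextP] : forall x, exists y, [/\ S y, x < y &
    forall s, S s -> x < s -> y <= s].
  move=> x; have [s0 Ss0 xs0] := Sunb x.
  have [r Sr] := (finite_seqP _).1 (fS s0).
  have inr y : S y -> y <= s0 -> y \in r.
    by move=> Sy ys; have : (S `&` [set s | s <= s0]) y by []; rewrite Sr.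
  have [|m] := @seq_min [seq y <- r | x < y].
    by apply/eqP => r0; have := inr _ Ss0 (lexx s0);
      apply/negP; rewrite -[s0 \in r]andTb -xs0 -mem_filter r0.
  rewrite mem_filter => /andP[xm mr] mmin.
  have [Sm ms0] : (S `&` [set s | s <= s0]) m by rewrite Sr.
  exists m; split=> // y Sy xy; have [ys0|/ltW s0y] := leP y s0.
    by apply: mmin; rewrite mem_filter xy inr.
  exact: le_trans ms0 s0y.
pose mut n := iter n.-1 next 0.
have mutS n : mut n.+2 = next (mut n.+1) by [].
have Smut n : S (mut n.+1).
  by elim: n => // n _; rewrite mutS; case: (nextP (mut n.+1)).
have mut_lt n : mut n.+1 < mut n.+2 by case: (nextP (mut n.+1)).
have mut_mono j k : (1 <= j)%N -> (j < k)%N -> mut j < mut k.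
  case: j => // j _; case: k => // k; rewrite ltnS => jk.
  exact: (homo_ltn lt_trans (fun n => mut_lt n)).
exists mut => //; split=> //; apply/seteqP; split=> [_ [[|n] // _ <-]//|s Ss].
apply: contrapT => nots.
have below n : mut n.+1 < s.
  have ne n' : mut n'.+1 != s by apply/eqP => e; apply: nots; exists n'.+1.
  elim: n => [|n ih]; first by rewrite lt_neqAle ne Spos.
  by rewrite lt_neqAle ne mutS; case: (nextP (mut n.+1)) => _ _ ->.
have : finite_set (range (fun n => mut n.+1)).
  apply: sub_finite_set (fS s) => _ [n _ <-]; split; first exact: Smut.
  exact/ltW.
have inj : injective (fun n => mut n.+1).
  move=> m n /eqP; apply: contraTeq; rewrite neq_ltn.
  by case/orP => mn; [rewrite lt_eqF|rewrite gt_eqF]; rewrite // mut_mono.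
move=> /(finite_preimage (in2W inj)); apply: contra_not infinite_nat => h.
by apply: sub_finite_set h => n _ /=; exists n.
Qed.

End Enumeration.

Section Exponents.
Context {R : realType}.
Variables (dstar Nstar n0 : nat) (lam beta : nat -> R).
Hypothesis n0_range : (1 <= n0 <= dstar)%N.
Hypothesis lam_incr : forall j k : nat,
  (1 <= j)%N -> (j < k)%N -> (k <= dstar)%N -> lam j < lam k.
Hypothesis lam_gt0 : 0 < lam n0.
Hypothesis Nstar_ge1 : (1 <= Nstar)%N.
Hypothesis beta_gt1 : forall k : nat, (1 <= k <= Nstar)%N -> 1 < beta k.

Let S := Stilde dstar Nstar n0 lam beta.

Let gap_ge0 k : k \in index_iota n0 dstar.+1 -> 0 <= lam k - lam n0.
Proof.
rewrite mem_index_iota ltnS leq_eqVlt => /andP[/predU1P[<-|n0k] kd].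
  by rewrite subrr.
by rewrite subr_ge0 ltW// lam_incr//; case/andP: n0_range.
Qed.

Lemma alpha_gt0 j : (1 <= j <= Nstar)%N -> 0 < (beta j - 1) * lam n0.
Proof. by move=> /beta_gt1 b1; rewrite mulr_gt0// subr_gt0. Qed.

Let alpha_ge0 j : j \in index_iota 1 Nstar.+1 -> 0 <= (beta j - 1) * lam n0.
Proof. by rewrite mem_index_iota ltnS => jN; exact/ltW/alpha_gt0. Qed.

Let S1 := [set s | exists m : nat -> nat,
  s = \sum_(k <- index_iota n0 dstar.+1) (m k)%:R * (lam k - lam n0)].
Let S2 := [set s | exists z : nat -> nat,
  s = \sum_(j <- index_iota 1 Nstar.+1) (z j)%:R * ((beta j - 1) * lam n0)].

Let S1_ge0 s : S1 s -> 0 <= s.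
Proof.
by move=> [m ->]; rewrite big_seq sumr_ge0// => k kr; rewrite mulr_ge0// gap_ge0.
Qed.

Let S2_ge0 s : S2 s -> 0 <= s.
Proof.
by move=> [m ->]; rewrite big_seq sumr_ge0// => k kr; rewrite mulr_ge0// alpha_ge0.
Qed.

Lemma Stilde_ge0 s : S s -> 0 <= s.
Proof. by move=> [m [z ->]]; apply: addr_ge0; [apply: S1_ge0; exists m|apply: S2_ge0; exists z]. Qed.

Lemma Stilde_locally_finite : locally_finite S.
Proof.
move=> B; apply: sub_finite_set (locally_finite_sum S1_ge0 S2_ge0
  (locally_finite_combinations gap_ge0) (locally_finite_combinations alpha_ge0) B).
move=> s [[m [z sE]] sB]; split=> //.
by do 2 eexists; split; [exists m; reflexivity|exists z; reflexivity|].
Qed.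

Lemma StildeD s t : S s -> S t -> S (s + t).
Proof.
move=> [m [z ->]] [m' [z' ->]]; exists (fun k => m k + m' k)%N, (fun k => z k + z' k)%N.
rewrite addrACA -!big_split /=; congr (_ + _); apply: eq_bigr => k _;
  by rewrite natrD [RHS]mulrDl.
Qed.

Lemma Stilde0 : S 0.
Proof.
by exists (fun=> 0%N), (fun=> 0%N); rewrite !big1 ?addr0// => k _; rewrite mul0r.
Qed.

Let sum_indicator (r : seq nat) (g : nat -> R) k : k \in r -> uniq r ->
  \sum_(j <- r) ((j == k) : nat)%:R * g j = g k.
Proof.
move=> kr ur; rewrite (bigD1_seq k)//= eqxx mul1r big1 ?addr0// => j jk.
by rewrite (negbTE jk) mul0r.
Qed.

Lemma Stilde_gap k : (n0 <= k <= dstar)%N -> S (lam k - lam n0).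
Proof.
move=> kr; exists (fun j => (j == k) : nat), (fun=> 0%N).
rewrite [X in _ = _ + X]big1 ?addr0; last by move=> j _; rewrite mul0r.
by rewrite (sum_indicator (fun j => lam j - lam n0)) ?iota_uniq// mem_index_iota ltnS.
Qed.

Lemma Stilde_alpha j : (1 <= j <= Nstar)%N -> S ((beta j - 1) * lam n0).
Proof.
move=> jr; exists (fun=> 0%N), (fun k => (k == j) : nat).
rewrite [X in _ = X + _]big1 ?add0r; last by move=> k _; rewrite mul0r.
by rewrite (sum_indicator (fun j => (beta j - 1) * lam n0)) ?iota_uniq// mem_index_iota ltnS.
Qed.

Lemma Stilde_unbounded B : exists2 s, S s & B < s.
Proof.
have r1 : (1 <= 1 <= Nstar)%N by [].
have a0 := alpha_gt0 r1; set a := (_ * _) in a0.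
have Sn n : S (n%:R * a).
  elim: n => [|n ih]; first by rewrite mul0r; exact: Stilde0.
  by rewrite -natr1 mulrDl mul1r; apply: StildeD => //; exact: Stilde_alpha.
exists ((Num.truncn `|B / a|).+1%:R * a) => //.
by rewrite -ltr_pdivrMr// (le_lt_trans (ler_norm _))// truncnS_gt.
Qed.

Lemma Stilde_enumeration :
  exists2 mut : nat -> R, mut 1%N = 0 & increasing_enumeration mut S.
Proof.
apply: locally_finite_enumeration; [exact: Stilde_locally_finite|
  exact: Stilde0|exact: Stilde_ge0|exact: Stilde_unbounded].
Qed.

End Exponents.

(** * Polynomial solutions of the equations for the coefficients *)

Section PolynomialEquation.
Context {R : realType}.

Lemma poly_antiderivative (p : {poly R}) : exists s : {poly R}, s^`() = p.
Proof.
exists (\sum_(i < size p) (p`_i / i.+1%:R) *: 'X^(i.+1)).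
rewrite raddf_sum -[RHS]coefK poly_def; apply: eq_bigr => i _.
by rewrite /= derivZ derivXn -scalerMnr scalerMnl -mulr_natr divfK ?pnatr_eq0.
Qed.

(** If [c <> 0], then [c^-1 *: p] is a solution up to the error [c^-1 *: p^`()] of
    smaller degree. *)
Lemma poly_linear_equation (c : R) (p : {poly R}) :
  exists s : {poly R}, s^`() + c *: s = p.
Proof.
have [->|c0] := eqVneq c 0.
  by have [s sp] := poly_antiderivative p; exists s; rewrite scale0r addr0.
move: {2}(size p) (leqnn (size p)) => n; elim: n p => [|n ih] p.
  by rewrite leqn0 size_poly_eq0 => /eqP ->; exists 0; rewrite deriv0 scaler0 addr0.
move=> spn; have [|s sE] := ih (- c^-1 *: p^`()).
  rewrite (leq_trans (size_scale_leq _ _))//.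
  have [->|p0] := eqVneq p 0; first by rewrite deriv0 size_poly0.
  by rewrite -ltnS (leq_trans (lt_size_deriv p0)).
exists (s + c^-1 *: p).
rewrite derivD derivZ scalerDr scalerA mulfV// scale1r addrACA sE scaleNr.
by rewrite addKr.
Qed.

Lemma is_derive_exp_poly (m t : R) (s : {poly R}) :
  is_derive t (1 : R) (fun t => expR (- m * t) * s.[t])
    (expR (- m * t) * (s^`().[t] - m * s.[t])).
Proof.
have ? := is_derive_expRM (- m) t; have ? := is_derive_poly s t.
apply: is_derive_eq.
rewrite -[LHS]/(expR (- m * t) * s^`().[t] + s.[t] * (- m * expR (- m * t))).
by ring.
Qed.

(** The constant of integration [c] is absorbed by the polynomial at a
    resonance [a = m], is negligible when [m < a], and has to vanish when
    [a <= m0], because the solution decays faster than [exp (- m0 t)]. *)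
Lemma coordinate_coefficient (z g : R -> R) (a m0 m e : R) (p : {poly R}) :
  0 < e -> m0 < m -> a <= m0 \/ m <= a ->
  (\forall t \near +oo,
    is_derive t (1 : R) z (g t + expR (- m * t) * p.[t] - a * z t)) ->
  decays (m + e) g -> decays (m0 + e) z ->
  exists s e', [/\ s^`() + (a - m) *: s = p, 0 < e' &
    decays (m + e') (fun t => z t - expR (- m * t) * s.[t])].
Proof.
move=> e0 m0m am dz dg z_dec.
have [s sE] := poly_linear_equation (a - m) p.
pose v t := z t - expR (- m * t) * s.[t].
have dv : \forall t \near +oo, is_derive t (1 : R) v (g t - a * v t).
  apply: filterS dz => t dzt; have ? := is_derive_exp_poly m t s.
  apply: is_derive_eq; rewrite -sE hornerD hornerZ /v; ring.
have rate_lt : m + e / 2 < m + e by lra.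
have [c dc] := scalar_asymptotics rate_lt dv dg.
have e2 : 0 < e / 2 by lra.
have dce : decays a (fun t => c * expR (- a * t)).
  by have := decaysM (decays_cst c) (decays_expR a); rewrite add0r.
have [am_eq|am_neq] := eqVneq a m.
  exists (s + c%:P), (e / 2); split=> //.
    by rewrite derivD derivC addr0 am_eq subrr !scale0r in sE *.
  apply: decays_eq dc; near=> t; rewrite /v am_eq hornerD hornerC.
  by rewrite mulrDr opprD addrA [c * _]mulrC.
have [a_le|m_le] := am.
  pose k := Num.min (e / 2) ((m - m0) / 2).
  have k0 : 0 < k by rewrite lt_min e2 divr_gt0// subr_gt0.
  have [ke km] : k <= e / 2 /\ k <= (m - m0) / 2 by apply/andP; rewrite -le_min.
  have ds : decays (m0 + k) (fun t => expR (- m * t) * s.[t]).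
    apply: decays_weaken (decaysM (decays_expR m) (decays_horner s k0)); lra.
  have d1 : decays (m0 + k) z by apply: decays_weaken z_dec; lra.
  have d2 : decays (m0 + k) (fun t => v t - c * expR (- a * t)).
    by apply: decays_weaken dc; lra.
  have c0 : c = 0.
    apply: (@decays_exp_coef0 _ a (m0 + k)); first by lra.
    apply: decays_eq (decaysB (decaysB d1 ds) d2); near=> t; rewrite /v; ring.
  exists s, (e / 2); split=> //; apply: decays_eq dc; near=> t.
  by rewrite c0 mul0r subr0.
have lt_ma : m < a by rewrite lt_neqAle eq_sym am_neq.
pose k := Num.min (e / 2) (a - m).
have k0 : 0 < k by rewrite lt_min e2 subr_gt0.
have [ke ka] : k <= e / 2 /\ k <= a - m by apply/andP; rewrite -le_min.
exists s, k; split=> //.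
have d1 : decays (m + k) (fun t => v t - c * expR (- a * t)).
  by apply: decays_weaken dc; lra.
have d2 : decays (m + k) (fun t => c * expR (- a * t)).
  by apply: decays_weaken dce; lra.
by apply: decays_eq (decaysD d1 d2); near=> t; rewrite subrK.
Unshelve. all: by end_near. Qed.

End PolynomialEquation.

(** * Expansion of the nonlinear term along an exponential sum *)

Lemma decays_small {R : realType} {V : normedModType R} (rho r : R) (f : R -> V) :
  0 < rho -> 0 < r -> decays rho f -> \forall t \near +oo, `|f t| <= r.
Proof. by move=> rho0 r0 /(decays_cvg0 rho0)/cvgr0_norm_le; apply. Qed.

Lemma decays_peval {R : realType} {d : nat} (e : R) (q : 'cV[{poly R}]_d) :
  0 < e -> decays (- e) (peval q).
Proof.
move=> e0; apply/decays_coordP => i; apply: decays_eq (decays_horner (q i 0) e0).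
by near=> t; rewrite pevalE.
Unshelve. all: by end_near. Qed.

Lemma open_neq0 {R : realType} {d : nat} : open [set x : 'cV[R]_d | x <> 0].
Proof.
rewrite (_ : mkset _ = ~` [set 0]); last by apply/seteqP; split.
apply: closed_openC; apply: accessible_closed_set1.
exact/hausdorff_accessible/norm_hausdorff.
Qed.

Section Expansion.
Context {R : realType} {d : nat}.
Variables (S : set R) (mut : nat -> R) (L : R) (xi : 'cV[R]_d).
Hypothesis mut1 : mut 1%N = 0.
Hypothesis mut_enum : increasing_enumeration mut S.
Hypothesis SD : forall s t, S s -> S t -> S (s + t).
Hypothesis xi_neq0 : xi <> 0.

Lemma mut_in n : (1 <= n)%N -> S (mut n).
Proof. by move=> n1; case: mut_enum => _ <-; exists n. Qed.

Lemma mut_onto s : S s -> exists2 n, (1 <= n)%N & s = mut n.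
Proof. by case: mut_enum => _ <- [n n1 <-]; exists n. Qed.

Lemma mut_lt j k : (1 <= j)%N -> (1 <= k)%N -> (mut j < mut k) = (j < k)%N.
Proof.
case: mut_enum => mono _ j1 k1; have [jk|kj] := ltnP j k; first exact: mono.
apply/negbTE; rewrite -leNgt; move: kj; rewrite leq_eqVlt => /predU1P[->//|kj].
exact/ltW/mono.
Qed.

Lemma mut_le j k : (1 <= j)%N -> (1 <= k)%N -> (mut j <= mut k) = (j <= k)%N.
Proof. by move=> j1 k1; rewrite leNgt mut_lt// -leqNgt. Qed.

Lemma mut_eq j k : (1 <= j)%N -> (1 <= k)%N -> (mut j == mut k) = (j == k).
Proof. by move=> j1 k1; rewrite eq_le !mut_le// eqn_leq. Qed.

Lemma mut_succ_le N s : (1 <= N)%N -> S s -> mut N < s -> mut N.+1 <= s.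
Proof. by move=> N1 /mut_onto[n n1 ->]; rewrite mut_lt// mut_le. Qed.

Let S0 : S 0. Proof. by rewrite -mut1; exact: mut_in. Qed.

Lemma mut2_gt0 : 0 < mut 2. Proof. by rewrite -mut1 mut_lt. Qed.

Lemma mut_ge0 n : (1 <= n)%N -> 0 <= mut n.
Proof. by move=> n1; rewrite -mut1 mut_le. Qed.

Let sigma (ks : seq nat) := \sum_(k <- ks) mut k.

Let sigma_in ks : all (leq 2) ks -> S (sigma ks).
Proof.
elim: ks => [_|k ks ih /= /andP[k2 /ih]]; first by rewrite /sigma big_nil; exact: S0.
by rewrite /sigma big_cons; apply: SD; apply: mut_in; exact: ltnW.
Qed.

Let sigma_ge ks : all (leq 2) ks -> (size ks)%:R * mut 2 <= sigma ks.
Proof.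
elim: ks => [_|k ks ih /= /andP[k2 /ih h]]; first by rewrite /sigma big_nil mul0r.
by rewrite /sigma big_cons -natr1 mulrDl mul1r addrC lerD// mut_le// ltnW.
Qed.

Let mut_le_sigma ks k : all (leq 2) ks -> k \in ks -> mut k <= sigma ks.
Proof.
elim: ks => // j ks ih /= /andP[j2 ks2]; rewrite in_cons /sigma big_cons.
have sig0 : 0 <= sigma ks by rewrite (le_trans _ (sigma_ge ks2))// mulr_ge0// ltW// mut2_gt0.
case/predU1P => [->|kks]; first by rewrite lerDl.
by rewrite (le_trans (ih ks2 kks))// lerDr mut_ge0// ltnW.
Qed.

Let tuples N M := flatten [seq words (index_iota 2 N.+1) m | m <- iota 0 M].

Let tuplesS N M : tuples N M.+1 = tuples N M ++ words (index_iota 2 N.+1) M.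
Proof. by rewrite /tuples -[M.+1]addn1 iotaD map_cat flatten_cat/= cats0. Qed.

Let mem_tuples N M ks :
  (ks \in tuples N M) = (size ks < M)%N && all (mem (index_iota 2 N.+1)) ks.
Proof.
elim: M => // M ih; rewrite tuplesS mem_cat ih mem_words -andb_orl orbC.
by rewrite ltnS [in RHS]leq_eqVlt.
Qed.

Let tuples_uniq N M : uniq (tuples N M).
Proof.
elim: M => // M ih; rewrite tuplesS cat_uniq ih words_uniq ?iota_uniq// andbT.
apply/hasPn => ks; rewrite mem_words mem_tuples => /andP[/eqP -> _].
by rewrite ltnn.
Qed.

Let tuples_ge2 N M ks : ks \in tuples N M -> all (leq 2) ks.
Proof.
rewrite mem_tuples => /andP[_]; apply: sub_all => k /=.
by rewrite mem_index_iota => /andP[].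
Qed.

(** Since [al > 0], every [mut k] of the sum is smaller than [mut n]. *)
Lemma index_tuples_lt (al : R) n ks : 0 < al -> (1 <= n)%N ->
  index_tuples mut al n ks -> {in ks, forall k, (1 < k < n)%N}.
Proof.
move=> al0 n1 [ks2 sal] k kks; have k2 : (2 <= k)%N := allP ks2 _ kks.
rewrite k2 -(mut_lt (ltnW k2))//.
by rewrite (le_lt_trans (mut_le_sigma ks2 kks))// -sal ltrDl.
Qed.

(** A solution of [sigma ks + al = mut n] has entries below [n] and length at
    most [mut n / mut 2], so it is found in a finite list that serves all
    [n <= N.+1] simultaneously. *)
Lemma index_tuples_sum (V : nmodType) (f : seq nat -> V) (al : R) n N M :
  0 < al -> (1 <= n <= N.+1)%N -> mut N.+1 <= M%:R * mut 2 ->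
  \sum_(ks \in index_tuples mut al n) f ks =
  \sum_(ks <- tuples N M | sigma ks + al == mut n) f ks.
Proof.
move=> al0 /andP[n1 nN] NM; rewrite -[RHS]big_filter [RHS]fsbig_seq; last first.
  exact/filter_uniq/tuples_uniq.
suff -> : index_tuples mut al n =
  [set` [seq ks <- tuples N M | sigma ks + al == mut n]] by [].
apply/seteqP; split=> ks /=; rewrite mem_filter.
- move=> [ks2 sal]; rewrite -/(sigma ks) in sal.
  rewrite sal eqxx/= mem_tuples.
  have sn : sigma ks < mut N.+1.
    by rewrite (lt_le_trans (_ : sigma ks < mut n)) ?mut_le// -sal ltrDl.
  apply/andP; split.
    rewrite -(ltr_nat R) -(ltr_pM2r mut2_gt0).
    exact: le_lt_trans (sigma_ge ks2) (lt_le_trans sn NM).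
  apply/allP => k kks; rewrite /= mem_index_iota.
  have /andP[-> kn] := index_tuples_lt al0 n1 (conj ks2 sal) kks.
  exact: leq_trans kn nN.
- by move=> /andP[/eqP sal /tuples_ge2 ks2].
Qed.

(** Each exponent [s i <= mut N] is [mut n] for exactly one [n] between [1] and
    [N]. *)
Lemma sum_by_exponent (V : nmodType) (I : eqType) (r : seq I) (s : I -> R)
    (X : I -> V) N : (1 <= N)%N -> {in r, forall i, S (s i)} ->
  \sum_(i <- r | s i <= mut N) X i =
  \sum_(1 <= n < N.+1) \sum_(i <- r | s i == mut n) X i.
Proof.
move=> N1 Sr; rewrite big_mkcond/=.
under [RHS]eq_bigr do rewrite big_mkcond/=.
rewrite exchange_big/= [LHS]big_seq [RHS]big_seq; apply: eq_bigr => i ir.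
have [n n1 ->] := mut_onto (Sr _ ir).
rewrite mut_le//; case: ifPn => nN.
  rewrite (bigD1_seq n) ?iota_uniq ?mem_index_iota ?n1//= eqxx big1_seq ?addr0// => j /=.
  rewrite mem_index_iota => /andP[jn /andP[j1 _]].
  by rewrite mut_eq// eq_sym (negbTE jn).
rewrite big1_seq// => j /=; rewrite mem_index_iota ltnS => /andP[j1 jN].
by rewrite mut_eq//; case: eqP => // nj; rewrite nj jN in nN.
Qed.

Lemma Fcal_peval (q : nat -> 'cV[{poly R}]_d) ks G :
  smooth_on [set x | x <> 0] G ->
  exists p, forall t, Fcal G xi [seq peval (q k) t | k <- ks] = peval p t.
Proof.
move=> sG; have [p Hp] := mderive_peval [::] ks q open_neq0 sG xi_neq0.
exists ((size ks)`!%:R^-1%:P *: p) => t.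
by rewrite pevalZ hornerC -Hp /Fcal size_map.
Qed.

Lemma index_tuples_peval (q : nat -> 'cV[{poly R}]_d) G (al : R) n :
  0 < al -> (1 <= n)%N -> smooth_on [set x | x <> 0] G ->
  exists p, forall t, \sum_(ks \in index_tuples mut al n)
    Fcal G xi [seq peval (q k) t | k <- ks] = peval p t.
Proof.
move=> al0 n1 sG; have /choice[p Hp] := fun ks => Fcal_peval q ks sG.
have [M HM] : exists M, mut n.+1 <= M%:R * mut 2.
  exists (Num.truncn `|mut n.+1 / mut 2|).+1.
  by rewrite -ler_pdivrMr ?mut2_gt0// ltW// (le_lt_trans (ler_norm _))// truncnS_gt.
exists (\sum_(ks <- tuples n M | sigma ks + al == mut n) p ks) => t.
rewrite (index_tuples_sum _ al0 _ HM) ?n1//= -[LHS]big_filter -[in RHS]big_filter.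
by rewrite peval_sum; apply: eq_bigr.
Qed.

Section OneTerm.
Variables (G : 'cV[R]_d -> 'cV[R]_d) (beta al : R) (N : nat).
Variables (q : nat -> 'cV[{poly R}]_d) (y : R -> 'cV[R]_d) (delta delta' : R).
Hypothesis G_hom : homogeneous beta G.
Hypothesis G_smooth : smooth_on [set x | x <> 0] G.
Hypothesis alE : al = (beta - 1) * L.
Hypothesis al_in : S al.
Hypothesis al_gt0 : 0 < al.
Hypothesis N_ge1 : (1 <= N)%N.
Hypothesis delta_gt0 : 0 < delta.
Hypothesis delta'_le : delta' <= delta.
Hypothesis delta'_lt : delta' < mut N.+2 - mut N.+1.
Hypothesis q1E : forall t, peval (q 1%N) t = xi.
Hypothesis y_expansion : decays (mut N + L + delta) (fun t => y t -
  \sum_(1 <= n < N.+1) expR (- (mut n + L) * t) *: peval (q n) t).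

Let u t := expR (L * t) *: y t - xi.
Let U t := \sum_(k <- index_iota 2 N.+1) expR (- mut k * t) *: peval (q k) t.

(* Half of the smallest positive exponent is the decay rate kept by [U] once its
   polynomial factors are paid for. *)
Let half_mut2 : 0 < mut 2 / 2. Proof. by rewrite divr_gt0// mut2_gt0. Qed.

Let decays_uU : decays (mut N + delta) (fun t => u t - U t).
Proof.
have := decaysZ (decays_expR (- L)) y_expansion.
rewrite [X in decays X _](_ : _ = mut N + delta); last by ring.
apply: decays_eq; near=> t.
rewrite opprK scalerBr /u -addrA; congr (_ + _).
rewrite big_ltn ?ltnS// q1E mut1 add0r scalerDr opprD scalerA -expRD.
rewrite mulNr addrN expR0 scale1r; congr (_ - _).
rewrite scaler_sumr; apply: eq_bigr => k _; rewrite scalerA -expRD.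
by congr (expR _ *: _); ring.
Unshelve. all: by end_near. Qed.

Let decays_U : decays (mut 2 / 2) U.
Proof.
apply: decays_sum => k; rewrite mem_index_iota => /andP[k2 _] _.
apply: decays_weaken (decaysZ (decays_expR (mut k)) (decays_peval (q k) half_mut2)).
have : mut 2 <= mut k by rewrite mut_le// ltnW.
by lra.
Qed.

Let G_at_y t : G (y t) = expR (- (al + L) * t) *: G (xi + u t).
Proof.
have -> : y t = expR (- L * t) *: (xi + u t).
  by rewrite /u addrC subrK scalerA -expRD -mulrDl addNr mul0r expR0 scale1r.
rewrite G_hom ?expR_gt0// -expRM alE; congr (expR _ *: _); ring.
Qed.

Let lipschitz_remainder :
  decays (mut N + delta) (fun t => G (xi + u t) - G (xi + U t)).
Proof.
have [C [r [C0 r0 HC]]] := mderive_taylor 1 open_neq0 G_smooth xi_neq0.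
have mN : 0 < mut N + delta by rewrite ltr_wpDl// mut_ge0.
have nU := decays_small half_mut2 r0 decays_U.
have nu := decays_small mN r0 decays_uU.
apply: (decays_dominated (K := C) decays_uU); near=> t.
have := HC (xi + U t) (u t - U t).
rewrite big_ord1 fact0 invr1 scale1r expr1 [xi + U t - xi]addrC addKr.
rewrite addrACA subrr addr0; apply; by near: t.
Unshelve. all: by end_near. Qed.

Let taylor_remainder M : decays (M%:R * (mut 2 / 2)) (fun t => G (xi + U t) -
  \sum_(m < M) m`!%:R^-1 *: mderive G (nseq m (U t)) xi).
Proof.
have [C [r [C0 r0 HC]]] := mderive_taylor M open_neq0 G_smooth xi_neq0.
have nU := decays_small half_mut2 r0 decays_U.
apply: (decays_powR (C := C) _ decays_U); first exact: ler0n.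
near=> t; rewrite powR_mulrn//; apply: HC; first by rewrite subrr normr0 ltW.
by near: t.
Unshelve. all: by end_near. Qed.

Let taylor_sum M t : \sum_(m < M) m`!%:R^-1 *: mderive G (nseq m (U t)) xi =
  \sum_(ks <- tuples N M)
    expR (- sigma ks * t) *: Fcal G xi [seq peval (q k) t | k <- ks].
Proof.
have -> : tuples N M =
    flatten [seq words (index_iota 2 N.+1) m | m <- index_iota 0 M].
  by rewrite /index_iota subn0.
rewrite big_flatten big_map big_mkord.
apply: eq_bigr => m _.
have := mderive_nseq_sum (index_iota 2 N.+1) [::] m (fun k => expR (- mut k * t))
  (fun k => peval (q k) t) open_neq0 G_smooth xi_neq0.
rewrite cat0s -/(U t) => ->; rewrite scaler_sumr !big_seq.
apply: eq_bigr => ks; rewrite mem_words => /andP[/eqP szks _].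
rewrite /Fcal size_map szks !scalerA mulrC -expR_sum.
by congr (expR _ * _ *: _); rewrite -mulr_suml sumrN.
Qed.

Let exponent_in ks : all (leq 2) ks -> S (sigma ks + al).
Proof. by move=> ks2; apply: SD => //; exact: sigma_in. Qed.

Let term ks t := expR (- (sigma ks + al + L) * t) *:
  Fcal G xi [seq peval (q k) t | k <- ks].

(** An exponent beyond [mut N.+1] is at least [mut N.+2], and the difference pays
    for the polynomial factor. *)
Let late_terms M : decays (mut N.+1 + L + delta')
  (fun t => \sum_(ks <- tuples N M | ~~ (sigma ks + al <= mut N.+1)) term ks t).
Proof.
apply: decays_sum => ks /tuples_ge2 ks2; rewrite -ltNge => lt.
have ge := mut_succ_le (ltn0Sn N) (exponent_in ks2) lt.
have [p Hp] := Fcal_peval q ks G_smooth.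
have e0 : 0 < mut N.+2 - mut N.+1 - delta' by rewrite subr_gt0.
have dF : decays (- (mut N.+2 - mut N.+1 - delta'))
    (fun t => Fcal G xi [seq peval (q k) t | k <- ks]).
  by apply: decays_eq (decays_peval p e0); near=> t; rewrite Hp.
apply: decays_weaken (decaysZ (decays_expR (sigma ks + al + L)) dF); lra.
Unshelve. all: by end_near. Qed.

(** The Lipschitz error is of order [mut N + al + L + delta], and [mut N + al] is
    an exponent beyond [mut N], hence at least [mut N.+1]. *)
Theorem homogeneous_expansion :
  decays (mut N.+1 + L + delta') (fun t => G (y t) -
    \sum_(1 <= n < N.+2) expR (- (mut n + L) * t) *:
      \sum_(ks \in index_tuples mut al n)
        Fcal G xi [seq peval (q k) t | k <- ks]).
Proof.
(* The Taylor order [M] makes the Taylor remainder negligible and bounds the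
   length of the tuples that contribute up to [mut N.+1]. *)
have [M HM] : exists M, mut N.+1 + delta <= M%:R * (mut 2 / 2).
  exists (Num.truncn `|(mut N.+1 + delta) / (mut 2 / 2)|).+1.
  by rewrite -ler_pdivrMr// ltW// (le_lt_trans (ler_norm _))// truncnS_gt.
have NM : mut N.+1 <= M%:R * mut 2.
  by move: HM (mut_ge0 (ltn0Sn N)) delta_gt0; lra.
have dL := decaysZ (decays_expR (al + L)) lipschitz_remainder.
have dT := decaysZ (decays_expR (al + L)) (taylor_remainder M).
have mal : mut N.+1 <= mut N + al.
  by apply: mut_succ_le => //; [apply: SD => //; exact: mut_in|rewrite ltrDl].
have {}dL : decays (mut N.+1 + L + delta') (fun t =>
    expR (- (al + L) * t) *: (G (xi + u t) - G (xi + U t))).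
  by apply: decays_weaken dL; move: mal delta'_le; lra.
have {}dT : decays (mut N.+1 + L + delta') (fun t =>
    expR (- (al + L) * t) *: (G (xi + U t) -
      \sum_(m < M) m`!%:R^-1 *: mderive G (nseq m (U t)) xi)).
  by apply: decays_weaken dT; move: HM al_gt0 delta'_le; lra.
apply: decays_eq (decaysD (decaysD dL dT) (late_terms M)); near=> t.
rewrite -scalerDr addrA subrK scalerBr -G_at_y -addrA; congr (_ + _).
rewrite taylor_sum scaler_sumr.
have -> : \sum_(1 <= n < N.+2) expR (- (mut n + L) * t) *:
      \sum_(ks \in index_tuples mut al n) Fcal G xi [seq peval (q k) t | k <- ks]
    = \sum_(ks <- tuples N M | sigma ks + al <= mut N.+1) term ks t.
  rewrite sum_by_exponent//; last by move=> ks /tuples_ge2/exponent_in.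
  apply: eq_big_nat => n /andP[n1 nN].
  rewrite (index_tuples_sum _ al_gt0 _ NM) ?n1//.
  by rewrite scaler_sumr; apply: eq_bigr => ks /eqP <-.
have termE ks : expR (- (al + L) * t) *: (expR (- sigma ks * t) *:
    Fcal G xi [seq peval (q k) t | k <- ks]) = term ks t.
  by rewrite scalerA -expRD /term; congr (expR _ *: _); ring.
under eq_bigr do rewrite termE.
rewrite (bigID (fun ks => sigma ks + al <= mut N.+1))/=.
by rewrite opprD subrK.
Unshelve. all: by end_near. Qed.

End OneTerm.

End Expansion.

(** * Successive determination of the coefficients *)

Lemma peval_mulmx {R : realType} {d : nat} (M : 'M[R]_d) (q : 'cV[{poly R}]_d) t :
  peval (map_mx polyC M *m q) t = M *m peval q t.
Proof.
apply/colP => i; rewrite pevalE !mxE horner_sum; apply: eq_bigr => j _.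
by rewrite !mxE hornerM hornerC.
Qed.

Lemma deriv_mulmx {R : realType} {d : nat} (M : 'M[R]_d) (q : 'cV[{poly R}]_d) :
  map_mx (@deriv R) (map_mx polyC M *m q) =
  map_mx polyC M *m map_mx (@deriv R) q.
Proof.
apply/colP => i; rewrite !mxE raddf_sum; apply: eq_bigr => j _.
by rewrite !mxE /= derivM derivC mul0r add0r.
Qed.

Lemma is_derive_sum_seq {R : realType} (I : eqType) (r : seq I) (f : I -> R -> R)
    (df : I -> R) (t : R) :
  {in r, forall i, is_derive t (1 : R) (f i) (df i)} ->
  is_derive t (1 : R) (fun s => \sum_(i <- r) f i s) (\sum_(i <- r) df i).
Proof.
elim: r => [_|i r ih dfr].
  rewrite big_nil (_ : (fun s => _) = cst 0); first exact: is_derive_cst.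
  by apply/funext => s; rewrite big_nil.
rewrite big_cons (_ : (fun s => _) = f i + fun s => \sum_(j <- r) f j s).
  apply: is_deriveD; first exact/dfr/mem_head.
  by apply: ih => j jr; apply: dfr; rewrite in_cons jr orbT.
by apply/funext => s; rewrite big_cons.
Qed.

Section Coefficients.
Context {R : realType} {d : nat}.
Variables (S : set R) (mut : nat -> R) (L : R) (xi : 'cV[R]_d).
Hypothesis mut1 : mut 1%N = 0.
Hypothesis mut_enum : increasing_enumeration mut S.
Hypothesis SD : forall s t, S s -> S t -> S (s + t).
Hypothesis xi_neq0 : xi <> 0.
Variables (A P : 'M[R]_d) (a : 'I_d -> R).
Hypothesis P_unit : P \in unitmx.
Hypothesis PA : forall i (x : 'cV[R]_d), (P *m (A *m x)) i 0 = a i * (P *m x) i 0.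
Hypothesis a_exponent : forall i, a i < L \/ S (a i - L).
Variables (F : 'cV[R]_d -> 'cV[R]_d) (y : R -> 'cV[R]_d).
Hypothesis y_C1 : C1_halfline y.
Hypothesis y_ode : forall t, 0 < t -> y^`()%classic t + A *m y t = F (y t).
Variables (Nstar : nat) (beta : nat -> R) (Fk : nat -> 'cV[R]_d -> 'cV[R]_d).
Hypothesis Fk_hom : forall k, (1 <= k <= Nstar)%N -> homogeneous (beta k) (Fk k).
Hypothesis Fk_smooth :
  forall k, (1 <= k <= Nstar)%N -> smooth_on [set x | x <> 0] (Fk k).
Let al r := (beta r - 1) * L.
Hypothesis al_in : forall r, (1 <= r <= Nstar)%N -> S (al r).
Hypothesis al_gt0 : forall r, (1 <= r <= Nstar)%N -> 0 < al r.
Variable rateF : R.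
Hypothesis F_remainder :
  decays rateF (fun t => F (y t) - \sum_(1 <= k < Nstar.+1) Fk k (y t)).

Let rhs (q : nat -> 'cV[{poly R}]_d) n t := \sum_(1 <= r < Nstar.+1)
  \sum_(ks \in index_tuples mut (al r) n)
    Fcal (Fk r) xi [seq peval (q k) t | k <- ks].

Let ode (p : 'cV[{poly R}]_d) (m : R) (f : R -> 'cV[R]_d) := forall t,
  peval (map_mx (@deriv R) p) t + (A - m%:M) *m peval p t = f t.

Let coord (p : 'cV[{poly R}]_d) i := (map_mx polyC P *m p) i 0.

Let coordE p i t : (coord p i).[t] = (P *m peval p t) i 0.
Proof. by rewrite -pevalE peval_mulmx. Qed.

Let ode_coordP p m f : ode p m f <-> forall i t,
  (coord p i)^`().[t] + (a i - m) * (coord p i).[t] = (P *m f t) i 0.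
Proof.
have E i t : (coord p i)^`().[t] + (a i - m) * (coord p i).[t] =
    (P *m (peval (map_mx (@deriv R) p) t + (A - m%:M) *m peval p t)) i 0.
  rewrite mulmxDr mxE -peval_mulmx -deriv_mulmx pevalE mxE; congr (_ + _).
  rewrite mulmxBl mulmxBr mxE PA mul_scalar_mx -scalemxAr coordE.
  by rewrite [X in _ = _ + X]mxE [X in _ = _ - X]mxE mulrBl.
split=> [pmf i t|pmf t]; first by rewrite E pmf.
by apply: (can_inj (mulKmx P_unit)); apply/colP => i; rewrite -E pmf.
Qed.

Let rhs_peval q n : (1 <= n)%N -> exists p, forall t, rhs q n t = peval p t.
Proof.
move=> n1.
have /choice[p Hp] : forall r, exists p, (1 <= r <= Nstar)%N -> forall t,
    \sum_(ks \in index_tuples mut (al r) n)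
      Fcal (Fk r) xi [seq peval (q k) t | k <- ks] = peval p t.
  move=> r; have [rN|rN] := boolP (1 <= r <= Nstar)%N; last by exists 0.
  have [p Hp] := index_tuples_peval mut1 mut_enum xi_neq0 q (al_gt0 rN) n1
    (Fk_smooth rN).
  by exists p.
exists (\sum_(1 <= r < Nstar.+1) p r) => t; rewrite peval_sum.
by apply: eq_big_nat => r rN; exact: Hp.
Qed.

(** The equation for [q n] involves earlier coefficients only. *)
Let rhs_congr q q' n t : (1 <= n)%N -> (forall k, (k < n)%N -> q k = q' k) ->
  rhs q n t = rhs q' n t.
Proof.
move=> n1 qq'; apply: eq_big_nat => r rN; apply: eq_fsbigr => ks.
rewrite inE => /(index_tuples_lt mut1 mut_enum (al_gt0 rN) n1) lt.
congr (Fcal _ _ _); apply/eq_in_map => k /lt/andP[_ kn].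
by rewrite qq'.
Qed.

Let rhs_expansion q N delta delta' : (1 <= N)%N -> 0 < delta ->
  delta' <= delta -> delta' < mut N.+2 - mut N.+1 ->
  mut N.+1 + L + delta' <= rateF -> (forall t, peval (q 1%N) t = xi) ->
  decays (mut N + L + delta) (fun t => y t -
    \sum_(1 <= n < N.+1) expR (- (mut n + L) * t) *: peval (q n) t) ->
  decays (mut N.+1 + L + delta') (fun t => F (y t) -
    \sum_(1 <= n < N.+2) expR (- (mut n + L) * t) *: rhs q n t).
Proof.
move=> N1 d0 dd dlt drate q1 dy.
have dF := decays_weaken drate F_remainder.
have dFk : decays (mut N.+1 + L + delta') (fun t =>
    \sum_(r <- index_iota 1 Nstar.+1) (Fk r (y t) -
    \sum_(1 <= n < N.+2) expR (- (mut n + L) * t) *: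
      \sum_(ks \in index_tuples mut (al r) n)
        Fcal (Fk r) xi [seq peval (q k) t | k <- ks])).
  apply: decays_sum => r; rewrite mem_index_iota ltnS => rN _.
  exact: (homogeneous_expansion mut1 mut_enum SD xi_neq0 (Fk_hom rN)
    (Fk_smooth rN) erefl (al_in rN) (al_gt0 rN) N1 d0 dd dlt q1 dy).
apply: decays_eq (decaysD dF dFk); near=> t.
rewrite sumrB addrA subrK exchange_big/=; congr (_ - _).
by apply: eq_bigr => n _; rewrite scaler_sumr.
Unshelve. all: by end_near. Qed.

Let residual (q : nat -> 'cV[{poly R}]_d) N t := y t -
  \sum_(1 <= n < N.+1) expR (- (mut n + L) * t) *: peval (q n) t.

Let coord_exp_sum (g : nat -> R -> 'cV[R]_d) N i t :
  (P *m \sum_(1 <= n < N.+1) expR (- (mut n + L) * t) *: g n t) i 0 =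
  \sum_(1 <= n < N.+1) expR (- (mut n + L) * t) * (P *m g n t) i 0.
Proof.
rewrite mulmx_sumr summxE; apply: eq_bigr => n _.
by rewrite -scalemxAr mxE.
Qed.

Let is_derive_residual q N p i (t : R) : 0 < t ->
  (forall t, rhs q N.+1 t = peval p t) ->
  (forall n, (1 <= n <= N)%N -> ode (q n) (mut n + L) (rhs q n)) ->
  is_derive t (1 : R) (fun s => (P *m residual q N s) i 0)
    ((P *m (F (y t) -
        \sum_(1 <= n < N.+2) expR (- (mut n + L) * t) *: rhs q n t)) i 0
     + expR (- (mut N.+1 + L) * t) * (coord p i).[t]
     - a i * (P *m residual q N t) i 0).
Proof.
move=> t0 Hp q_ode.
have wE s : (P *m residual q N s) i 0 = (P *m y s) i 0 -
    \sum_(1 <= n < N.+1) expR (- (mut n + L) * s) * (coord (q n) i).[s].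
  rewrite mulmxBr mxE [X in _ + X]mxE (coord_exp_sum (fun n => peval (q n))).
  by congr (_ - _); apply: eq_bigr => n _; rewrite coordE.
have dy := is_derive_coord P i (C1_halfline_derivable y_C1 t0).
have dsum := is_derive_sum_seq (r := index_iota 1 N.+1)
  (fun n _ => is_derive_exp_poly (mut n + L) t (coord (q n) i)).
have -> : (fun s => (P *m residual q N s) i 0) = (fun s => (P *m y s) i 0) -
    (fun s => \sum_(1 <= n < N.+1) expR (- (mut n + L) * s) * (coord (q n) i).[s]).
  exact/funext.
apply: is_derive_eq (is_deriveB dy dsum) _.
have -> : y^`()%classic t = F (y t) - A *m y t by rewrite -y_ode// addrK.
rewrite wE mulmxBr mxE [X in _ + X - _]mxE PA.
rewrite mulmxBr [X in _ = X + _ - _]mxE [X in _ = _ + X + _ - _]mxE.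
rewrite coord_exp_sum [in RHS]big_nat_recr//= Hp coordE.
have -> : \sum_(1 <= n < N.+1) expR (- (mut n + L) * t) *
      ((coord (q n) i)^`().[t] - (mut n + L) * (coord (q n) i).[t]) =
    \sum_(1 <= n < N.+1) expR (- (mut n + L) * t) * (P *m rhs q n t) i 0 -
    a i * \sum_(1 <= n < N.+1) expR (- (mut n + L) * t) * (coord (q n) i).[t].
  rewrite mulr_sumr -sumrB; apply: eq_big_nat => n nN.
  by have /ode_coordP/(_ i t) <- := q_ode n nN; ring.
ring.
Qed.

(** The part of the solution not yet described solves, coordinate by
    coordinate, a linear equation whose forcing term is known up to the next
    exponent; an eigenvalue below that exponent is already one of the previous
    ones, because the exponents contain all the gaps [a i - L >= 0]. *)
Theorem next_coefficient q N delta : (1 <= N)%N -> 0 < delta ->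
  mut N.+1 + L < rateF -> (forall t, peval (q 1%N) t = xi) ->
  (forall n, (1 <= n <= N)%N -> ode (q n) (mut n + L) (rhs q n)) ->
  decays (mut N + L + delta) (fun t => y t -
    \sum_(1 <= n < N.+1) expR (- (mut n + L) * t) *: peval (q n) t) ->
  exists q' delta', [/\ 0 < delta', forall t, peval (q' 1%N) t = xi,
    forall n, (1 <= n <= N.+1)%N -> ode (q' n) (mut n + L) (rhs q' n) &
    decays (mut N.+1 + L + delta') (fun t => y t -
    \sum_(1 <= n < N.+2) expR (- (mut n + L) * t) *: peval (q' n) t)].
Proof.
move=> N1 d0 lt_rate q1 q_ode dy.
set m := mut N.+1 + L.
have N_lt : mut N < mut N.+1 by rewrite (mut_lt mut_enum).
have N1_lt : mut N.+1 < mut N.+2 by rewrite (mut_lt mut_enum).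
(* The three constraints come from the decay of the remainder, from the gap to
   the exponent after the next, and from the accuracy of the expansion of [F]. *)
pose e := Num.min delta (Num.min ((mut N.+2 - mut N.+1) / 2) (rateF - m)).
have e0 : 0 < e.
  by rewrite !lt_min d0 subr_gt0 lt_rate divr_gt0// subr_gt0.
have e_delta : e <= delta by rewrite ge_min lexx.
have e_gap : e < mut N.+2 - mut N.+1.
  have : e <= (mut N.+2 - mut N.+1) / 2 by rewrite !ge_min lexx orbT.
  by move: N1_lt; lra.
have e_rate : m + e <= rateF.
  have : e <= rateF - m by rewrite !ge_min lexx !orbT.
  by lra.
have dE := rhs_expansion N1 d0 e_delta e_gap e_rate q1 dy.
set E := (fun t => F (y t) - _) in dE.
pose w := residual q N.
have [p Hp] := rhs_peval q (ltn0Sn N).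
have am i : a i <= mut N + L \/ m <= a i.
  have [|ai] := a_exponent i.
    by left; rewrite (le_trans (ltW _) (_ : L <= _))// lerDr (mut_ge0 mut1 mut_enum).
  have [?|lt] := leP (a i) (mut N + L); [by left|right].
  rewrite /m -lerBrDr; apply: (mut_succ_le mut_enum) => //.
  by rewrite ltrBrDr.
have /choice[s Hs] : forall i, exists s : {poly R}, s^`() + (a i - m) *: s = coord p i /\
    exists2 e', 0 < e' & decays (m + e') (fun t => (P *m w t) i 0 - expR (- m * t) * s.[t]).
  move=> i; have dwi : \forall t \near +oo, is_derive t (1 : R) (fun s => (P *m w s) i 0)
      ((P *m E t) i 0 + expR (- m * t) * (coord p i).[t] - a i * (P *m w t) i 0).
    by near=> t; apply: is_derive_residual => //; near: t; apply: nbhs_pinfty_gt; exact: num_real.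
  have dPE := (decays_coordP _ _).1 (decays_mulmx P dE) i.
  have dPw : decays (mut N + L + e) (fun t => (P *m w t) i 0).
    have dy' : decays (mut N + L + e) w by apply: decays_weaken dy; rewrite lerD2l.
    exact: (decays_coordP _ _).1 (decays_mulmx P dy') i.
  have m_lt : mut N + L < m by rewrite ltrD2r.
  have [s [e' [sE e'0 ds]]] := coordinate_coefficient e0 m_lt (am i) dwi dPE dPw.
  by exists s; split=> //; exists e'.
have /choice[e' He'] : forall i, exists e', 0 < e' /\
    decays (m + e') (fun t => (P *m w t) i 0 - expR (- m * t) * (s i).[t]).
  by move=> i; have [_ [e' ? ?]] := Hs i; exists e'.
have [delta' d'0 Hd'] := finite_gap (fun i => (He' i).1).
pose qN := map_mx polyC (invmx P) *m (\col_i s i).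
have coord_qN i : coord qN i = s i.
  rewrite /coord /qN mulmxA -map_mxM mulmxV// map_mx1 mul1mx mxE//.
pose q' n := if n == N.+1 then qN else q n.
have q'E n : (n < N.+1)%N -> q' n = q n.
  by move=> nN; rewrite /q' ltn_eqF.
exists q', delta'; split=> //.
- by move=> t; rewrite q'E ?ltnS.
- move=> n /andP[n1]; rewrite leq_eqVlt => /predU1P[->|nN]; last first.
    move=> t; rewrite (@rhs_congr q' q)//; last first.
      by move=> k kn; rewrite q'E// (ltn_trans kn).
    by rewrite q'E//; apply: q_ode; rewrite n1.
  rewrite {1}/q' eqxx; apply/ode_coordP => i t.
  rewrite (@rhs_congr q' q)// Hp.
  by rewrite coord_qN -coordE -(Hs i).1 hornerD hornerZ.
have resE t : residual q' N.+1 t = w t - expR (- m * t) *: peval qN t.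
  have -> : w t = residual q' N t.
    by congr (_ - _); apply: eq_big_nat => n /andP[_ nN]; rewrite q'E.
  rewrite /residual -[RHS]addrA -[in RHS]opprD; congr (_ - _).
  by rewrite [LHS]big_nat_recr//= /q' eqxx.
have dz : decays (m + delta') (fun t => P *m residual q' N.+1 t).
  apply/decays_coordP => i.
  have le_d : m + delta' <= m + e' i by rewrite lerD2l -[delta']add0r.
  apply: decays_eq (decays_weaken le_d (He' i).2); near=> t.
  rewrite resE [in RHS]mulmxBr -scalemxAr [RHS]mxE; congr (_ + _).
  by rewrite mxE mxE -coordE coord_qN.
apply: decays_eq (decays_mulmx (invmx P) dz); near=> t.
by rewrite mulKmx.
Unshelve. all: by end_near. Qed.

End Coefficients.

(** * The asymptotic expansion *)

Section Nonlinearity.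
Context {R : realType} {d : nat}.
Variables (F : 'cV[R]_d -> 'cV[R]_d) (Nstar : nat) (beta : nat -> R).
Variables (Fk : nat -> 'cV[R]_d -> 'cV[R]_d) (eps : R).
Hypothesis Nstar_ge1 : (1 <= Nstar)%N.
Hypothesis beta_incr : forall j k : nat,
  (1 <= j)%N -> (j < k)%N -> (k <= Nstar)%N -> beta j < beta k.
Hypothesis beta_gt1 : forall k : nat, (1 <= k <= Nstar)%N -> 1 < beta k.
Hypothesis Fk_hom :
  forall k : nat, (1 <= k <= Nstar)%N -> homogeneous (beta k) (Fk k).
Hypothesis Fk_smooth :
  forall k : nat, (1 <= k <= Nstar)%N -> smooth_on [set x | x <> 0] (Fk k).
Hypothesis eps_gt0 : 0 < eps.
Hypothesis F_expand : bigO_at (nbhs (0 : 'cV[R]_d))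
  (fun x => enorm (F x - \sum_(1 <= k < Nstar.+1) Fk k x))
  (fun x => enorm x `^ (beta Nstar + eps)).

Let beta1_gt1 : 1 < beta 1%N. Proof. exact: beta_gt1. Qed.

Let beta1_le k : (1 <= k <= Nstar)%N -> beta 1%N <= beta k.
Proof.
move=> /andP[]; rewrite leq_eqVlt => /predU1P[<-//|k1 kN].
exact/ltW/beta_incr.
Qed.

Let top_gt0 : 0 < beta Nstar + eps.
Proof.
rewrite addr_gt0// (lt_trans ltr01)// beta_gt1//.
by rewrite Nstar_ge1 leqnn.
Qed.

(** Near the origin the smallest of the exponents dominates. *)
Lemma nonlinearity_superlinear : exists r C, [/\ 0 < r, 0 <= C &
  forall x, `|x| <= r -> `|F x| <= C * `|x| `^ beta 1%N].
Proof.
have [C0 [C0_ge0 [r r0 FC]]] := bigO_near_norm (ltW top_gt0) F_expand.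
have /choice[C HC] : forall k, exists C, 0 <= C /\ ((1 <= k <= Nstar)%N ->
    forall x, `|Fk k x| <= C * `|x| `^ beta k).
  move=> k; have [kN|kN] := boolP (1 <= k <= Nstar)%N; last by exists 0.
  have bk0 : 0 < beta k by rewrite (lt_trans ltr01)// beta_gt1.
  have [|C C_ge0 HC] := homogeneous_bound bk0 (Fk_hom kN).
    by move=> x x0; apply: differentiable_continuous; exact: (Fk_smooth kN [::] x0).
  by exists C.
exists (Num.min r 1), (C0 + \sum_(1 <= k < Nstar.+1) C k); split.
- by rewrite lt_min r0 ltr01.
- by rewrite addr_ge0// sumr_ge0// => k _; case: (HC k).
move=> x; rewrite le_min => /andP[xr x1].
have b1_gt0 : 0 < beta 1%N by rewrite (lt_trans ltr01).
have pow_le p : beta 1%N <= p -> `|x| `^ p <= `|x| `^ beta 1%N.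
  by apply: powR_nonincreasing => //; rewrite normr_ge0.
rewrite -(subrK (\sum_(1 <= k < Nstar.+1) Fk k x) (F x)) mulrDl.
rewrite (le_trans (ler_normD _ _))// lerD//.
  rewrite (le_trans (FC x xr))// ler_wpM2l// pow_le//.
  by rewrite (le_trans (beta1_le (k := Nstar) _)) ?Nstar_ge1 ?leqnn// lerDl ltW.
rewrite (le_trans (ler_norm_sum _ _ _))// mulr_suml; apply: ler_sum_nat => k kN.
have [Ck_ge0 Ck] := HC k.
by rewrite (le_trans (Ck kN x))// ler_wpM2l// pow_le// beta1_le.
Qed.

Lemma nonlinearity_remainder (y : R -> 'cV[R]_d) (L : R) : 0 < L -> decays L y ->
  decays ((beta Nstar + eps) * L)
    (fun t => F (y t) - \sum_(1 <= k < Nstar.+1) Fk k (y t)).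
Proof.
move=> L0 dy.
have [C [C_ge0 [r r0 FC]]] := bigO_near_norm (ltW top_gt0) F_expand.
apply: (decays_powR (C := C) (ltW top_gt0) dy); near=> t; apply: FC.
by near: t; exact: decays_small L0 r0 dy.
Unshelve. all: by end_near. Qed.

End Nonlinearity.

Lemma max_index_exists (P : pred nat) : P 1%N ->
  (exists B, forall n, (B <= n)%N -> ~~ P n) -> exists N, is_max_index P N.
Proof.
move=> P1 [B PB].
have ex : exists n, (0 < n)%N && P n by exists 1%N.
have ub n : (0 < n)%N && P n -> (n <= B)%N.
  by move=> /andP[_ Pn]; rewrite leqNgt; apply: contraL Pn => /ltnW/PB.
case: (ex_maxnP ex ub) => N /andP[N0 PN] Nmax; exists N; split=> // n n0 Pn.
by apply: Nmax; rewrite n0 Pn.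
Qed.

Theorem theorem5p1 (R : realType) (d : nat) (hd : (1 <= d)%N)
  (A : 'M[R]_d) (hA : diagonalizable A)
  (dstar : nat) (lam : nat -> R)
  (hlam_incr : forall j k : nat,
     (1 <= j)%N -> (j < k)%N -> (k <= dstar)%N -> lam j < lam k)
  (hlam_pos : forall k : nat, (1 <= k <= dstar)%N -> 0 < lam k)
  (hlam_eig : forall a : R,
     eigenvalue A a <-> exists k : nat, (1 <= k <= dstar)%N /\ lam k = a)
  (F : 'cV[R]_d -> 'cV[R]_d) (hF_lip : locally_lipschitz F) (hF0 : F 0 = 0)
  (Nstar : nat) (hNstar : (1 <= Nstar)%N)
  (beta : nat -> R)
  (hbeta_incr : forall j k : nat,
     (1 <= j)%N -> (j < k)%N -> (k <= Nstar)%N -> beta j < beta k)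
  (hbeta_gt1 : forall k : nat, (1 <= k <= Nstar)%N -> 1 < beta k)
  (Fk : nat -> 'cV[R]_d -> 'cV[R]_d)
  (hFk_hom : forall k : nat,
     (1 <= k <= Nstar)%N -> homogeneous (beta k) (Fk k))
  (hFk_smooth : forall k : nat,
     (1 <= k <= Nstar)%N -> smooth_on [set x | x <> 0] (Fk k))
  (eps : R) (heps : 0 < eps)
  (hF_expand :
     bigO_at (nbhs (0 : 'cV[R]_d))
       (fun x => enorm (F x - \sum_(1 <= k < Nstar.+1) Fk k x))
       (fun x => enorm x `^ (beta Nstar + eps)))
  (y : R -> 'cV[R]_d) (hy_C1 : C1_halfline y)
  (hy_ode : forall t : R, 0 < t -> y^`()%classic t + A *m y t = F (y t))
  (hy0 : y 0 <> 0)
  (hy_lim : y t @[t --> +oo] --> (0 : 'cV[R]_d)) :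
  exists (n0 : nat) (xi : 'cV[R]_d),
    [/\ (1 <= n0 <= dstar)%N,
        xi <> 0,
        A *m xi = lam n0 *: xi,
        (exists delta0 : R, 0 < delta0 /\
           bigO_at (pinfty_nbhs R)
             (fun t => enorm (y t - expR (- lam n0 * t) *: xi))
             (fun t => expR (- (lam n0 + delta0) * t))) &
        exists (mut : nat -> R) (Nbar : nat) (q : nat -> 'cV[{poly R}]_d)
               (delta : R),
          let mu := fun n : nat => mut n + lam n0 in
          [/\ increasing_enumeration mut (Stilde dstar Nstar n0 lam beta),
              is_max_index
                (fun N => lam n0 * (beta Nstar + eps) > mu N) Nbar,
              0 < delta,
              bigO_at (pinfty_nbhs R)
                (fun t => enorm (y t - \sum_(1 <= n < Nbar.+1)
                                         expR (- mu n * t) *: peval (q n) t))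
                (fun t => expR (- (mu Nbar + delta) * t)) &
              forall n : nat, (1 <= n <= Nbar)%N -> forall t : R,
                peval (map_mx (@deriv R) (q n)) t
                  + (A - (mu n)%:M) *m peval (q n) t
                = \sum_(1 <= r < Nstar.+1)
                    \sum_(ks \in index_tuples mut ((beta r - 1) * lam n0) n)
                      Fcal (Fk r) xi [seq peval (q k) t | k <- ks]]].
Proof.
have [P [a [P_unit PA a_eig]]] := diagonalizable_eigenbasis hA.
have a_lam i : exists2 k : nat, (1 <= k <= dstar)%N & lam k = a i.
  by have [k []] := (hlam_eig (a i)).1 (a_eig i); exists k.
have a_gt0 i : 0 < a i by have [k kd <-] := a_lam i; exact: hlam_pos.
have b1 : 1 < beta 1%N by apply: hbeta_gt1; rewrite hNstar.
have [r [C [r0 C0 FC]]] := nonlinearity_superlinear hNstar hbeta_incr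
  hbeta_gt1 hFk_hom hFk_smooth heps hF_expand.
have [i0 [xi [xi0 Axi [e e0 dxi]]]] :=
  leading_asymptotics P_unit PA a_gt0 r0 b1 C0 FC hy_C1 hy_ode hy0 hy_lim.
have [n0 n0d n0E] := a_lam i0.
have L0 : 0 < lam n0 by exact: hlam_pos.
rewrite -n0E in Axi dxi.
exists n0, xi; split=> //.
  by exists e; split=> //; exact: bigO_enorm_decays.
have [mut mut1 mut_enum] := Stilde_enumeration n0d hlam_incr L0 hNstar hbeta_gt1.
have SD := @StildeD R dstar Nstar n0 lam beta.
have al_in k := @Stilde_alpha R dstar Nstar n0 lam beta k.
have al_gt0 k := @alpha_gt0 R Nstar n0 lam beta L0 hbeta_gt1 k.
have a_exponent i : a i < lam n0 \/ Stilde dstar Nstar n0 lam beta (a i - lam n0).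
  have [k /andP[k1 kd] <-] := a_lam i; have [kn0|n0k] := ltnP k n0.
    by left; apply: hlam_incr => //; case/andP: n0d.
  by right; apply: Stilde_gap; rewrite n0k.
have dy : decays (lam n0) y.
  have dE : decays (lam n0) (fun t => expR (- lam n0 * t) *: xi).
    by have := decaysZ (decays_expR (lam n0)) (decays_cst xi); rewrite addr0.
  have le_e : lam n0 <= lam n0 + e by rewrite lerDl ltW.
  apply: decays_eq (decaysD (decays_weaken le_e dxi) dE).
  by near=> t; rewrite subrK.
have dF := nonlinearity_remainder hNstar hbeta_gt1 heps hF_expand L0 dy.
have expansion N : (1 <= N)%N -> mut N + lam n0 < (beta Nstar + eps) * lam n0 ->
    exists (q : nat -> 'cV[{poly R}]_d) delta, [/\ 0 < delta,
      forall t, peval (q 1%N) t = xi,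
      forall n, (1 <= n <= N)%N -> forall t,
        peval (map_mx (@deriv R) (q n)) t
          + (A - (mut n + lam n0)%:M) *m peval (q n) t
        = \sum_(1 <= r < Nstar.+1)
            \sum_(ks \in index_tuples mut ((beta r - 1) * lam n0) n)
              Fcal (Fk r) xi [seq peval (q k) t | k <- ks] &
      decays (mut N + lam n0 + delta) (fun t => y t -
        \sum_(1 <= n < N.+1) expR (- (mut n + lam n0) * t) *: peval (q n) t)].
  elim: N => // -[|N] ih _ ltN; last first.
    have N_lt : mut N.+1 < mut N.+2 by rewrite (mut_lt mut_enum).
    have [//||q [delta [d0 q1 q_ode dq]]] := ih.
      by rewrite (lt_trans _ ltN)// ltrD2r.
    have [q' [delta' [d'0 q'1 q'_ode dq']]] := next_coefficient mut1 mut_enum SD xi0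
      P_unit PA a_exponent hy_C1 hy_ode hFk_hom hFk_smooth al_in al_gt0 dF
      (ltn0Sn N) d0 ltN q1 q_ode dq.
    by exists q', delta'.
  exists (fun=> map_mx polyC xi), e; split=> //.
  - by move=> t; apply/colP => i; rewrite pevalE mxE hornerC.
  - move=> n n11 t; have -> : n = 1%N by apply/eqP; rewrite eqn_leq andbC.
    rewrite mut1 add0r [RHS]big1_seq.
      have -> : peval (map_mx polyC xi) t = xi.
        by apply/colP => i; rewrite pevalE mxE hornerC.
      rewrite mulmxBl Axi mul_scalar_mx subrr addr0.
      by apply/colP => i; rewrite pevalE !mxE derivC horner0.
    move=> k; rewrite mem_index_iota ltnS => kN.
    rewrite (_ : index_tuples _ _ _ = set0) ?fsbig_set0//.
    apply/seteqP; split=> // ks [ks2] /eqP; rewrite mut1 gt_eqF//.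
    rewrite ltr_wpDl ?al_gt0// big_seq sumr_ge0// => j jks.
    by rewrite (mut_ge0 mut1 mut_enum)// ltnW// (allP ks2).
  - rewrite mut1 add0r; apply: decays_eq dxi; near=> t.
    rewrite big_nat1 mut1 add0r; congr (_ - _ *: _).
    by apply/colP => i; rewrite pevalE mxE hornerC.
pose Q n := mut n + lam n0 < lam n0 * (beta Nstar + eps).
have Q1 : Q 1%N.
  rewrite /Q mut1 add0r ltr_pMr//.
  by rewrite (lt_trans (hbeta_gt1 Nstar _)) ?hNstar ?leqnn// ltrDl.
have Qbounded : exists B, forall n, (B <= n)%N -> ~~ Q n.
  have [s Ss ltS] := Stilde_unbounded dstar L0 hNstar hbeta_gt1
    (lam n0 * (beta Nstar + eps)).
  have [B B1 sB] := mut_onto mut_enum Ss.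
  exists B => n Bn; rewrite /Q -leNgt ltW// (lt_le_trans ltS)// sB.
  by rewrite ler_wpDr ?(ltW L0)// (mut_le mut_enum)// (leq_trans B1).
have [Nbar [Nbar1 QNbar Nbar_max]] := max_index_exists Q1 Qbounded.
have [|q [delta [d0 _ q_ode dq]]] := expansion Nbar Nbar1.
  by rewrite [ltRHS]mulrC.
exists mut, Nbar, q, delta; split=> //.
exact: bigO_enorm_decays dq.
Unshelve. all: by end_near. Qed.
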